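(* Let $(G/H,\Pi)$ be a coisotropic Poisson homogeneous space and let $h\in C^\infty(G/H)$ be an $H$-Morse function at $eH$. If there exists a volume form $\nu$ on $G/H$ which is preserved by $X_h^\Pi$, i.e. $\mathcal{L}_{X_h^\Pi}\nu=0$, then $\mathfrak{h}^0$ is unimodular.
   Context: $(G,\Pi_G)$ is a connected Poisson-Lie group (multiplication $G\times G\to G$ is a Poisson map) with Lie algebra $\mathfrak{g}$; $H\subset G$ is a closed connected Lie subgroup with Lie algebra $\mathfrak{h}$; $q:G\to G/H$ is the projection. $\mathfrak{g}^*$ carries the Lie bracket $[\xi,\eta]_{\mathfrak{g}^*}(X)=\delta_{\Pi_G}(X)(\xi,\eta)$, where $\delta_{\Pi_G}(X)=[\overleftarrow{X},\Pi_G](e)\in\wedge^2\mathfrak{g}$ (Schouten bracket, $\overleftarrow{X}$ the left-invariant vector field with value $X$ at $e$). $(G/H,\Pi)$ is a coisotropic Poisson homogeneous space (coisotropic Poisson quotient) if $\Pi$ is a Poisson structure on $G/H$ such that the action $(G,\Pi_G)\times(G/H,\Pi)\to(G/H,\Pi)$, $(g,g'H)\mapsto gg'H$, is Poisson and $q:(G,\Pi_G)\to(G/H,\Pi)$ is a Poisson map; then $\mathfrak{h}^0=\{\xi\in\mathfrak{g}^*:\xi_{|\mathfrak{h}}=0\}$ is a Lie subalgebra of $\mathfrak{g}^*$. $X_h^\Pi=i_{dh}\Pi$ is the Hamiltonian vector field. A function $h\in C^\infty(G/H)$ is $H$-Morse at $eH$ if $dh(eH)=0$ and the Hessian of $h$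 at $eH$ is nondegenerate, where the Hessian is the symmetric bilinear form on $\mathfrak{g}/\mathfrak{h}\cong T_{eH}(G/H)$ given by $(\mathrm{Hess}\,h)_{eH}(X,Y)=X(V^Y(h))$, with $V^Y$ any vector field on $G/H$ such that $V^Y(eH)=Y$. A Lie algebra $\mathfrak{k}$ is unimodular if $\mathrm{Tr}(\mathrm{ad}^{\mathfrak{k}}_x)=0$ for all $x\in\mathfrak{k}$. *)

(* Defs.v *)
From HB Require Import structures.
From mathcomp Require Import all_boot all_order all_algebra generic_quotient.
From mathcomp Require Import all_classical all_reals all_analysis.

Set Implicit Arguments.
Unset Strict Implicit.
Unset Printing Implicit Defensive.

Import Order.TTheory GRing.Theory Num.Theory.
Import numFieldNormedType.Exports.

Local Open Scope classical_set_scope.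
Local Open Scope ring_scope.

(* Only the two structures on one carrier: continuity of the operations is part
   of [lie_group] below. *)
#[short(type="groupTopType")]
HB.structure Definition GroupTop := {G of Group G & Topological G}.

(* C^k and C^oo maps on an open subset [U] of a normed space; [U] is assumed to
   be open at each use, so ['d f x] only depends on [f] on [U]. *)
Section smooth_on.
Context {R : realType} {V W : normedModType R}.

Fixpoint Ck (k : nat) (U : set V) (f : V -> W) : Prop :=
  match k with
  | 0 => forall x, U x -> {for x, continuous f}
  | k'.+1 => (forall x, U x -> differentiable f x) /\
             (forall v, Ck k' U (fun x => 'd f x v))
  end.

Definition smooth_on (U : set V) (f : V -> W) := forall k, Ck k U f.

End smooth_on.

(* Charts are total functions; only their values on [cdom c], and those of
   [cinv c] on [ccodom c], are meaningful. *)
Record chart (R : realType) (T : topologicalType) (n : nat) := Chart {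
  cdom : set T;
  cfun :> T -> 'rV[R]_n;
  cinv : 'rV[R]_n -> T }.

Section charts.
Context {R : realType} {T : topologicalType} {n : nat}.
Implicit Types (c d : chart R T n) (p : T).

Definition ccodom c : set 'rV[R]_n := c @` cdom c.

Definition is_chart c :=
  [/\ open (cdom c), open (ccodom c),
      forall p, cdom c p -> cinv c (c p) = p,
      forall p, cdom c p -> {for p, continuous c}
    & forall x, ccodom c x -> {for x, continuous (cinv c)}].

(* [v *m chart_change c d p] are the components in the chart [d] of the tangent
   vector at [p] whose components in the chart [c] are [v]. *)
Definition chart_change c d p : 'M[R]_n := jacobian (d \o cinv c) (c p).

End charts.

(* An atlas with a preferred chart around each point.  The tangent space at [p]
   is represented by row vectors: the components in the preferred chart at [p].
   Covectors are also row vectors, paired with vectors by [pairing]. *)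
Record charted (R : realType) (T : topologicalType) (n : nat) := Charted {
  atlas : set (chart R T n);
  chart_at : T -> chart R T n }.

Definition dimension (R : realType) (T : topologicalType) n (_ : charted R T n) :=
  n.

Definition pairing (R : realType) n (xi v : 'rV[R]_n) : R := (xi *m v^T) 0 0.

(* B(xi, eta), for a bilinear form B given by its matrix *)
Definition bilin (R : realType) n (B : 'M[R]_n) (xi eta : 'rV[R]_n) : R :=
  (xi *m B *m eta^T) 0 0.

Section manifolds.
Context {R : realType} {T : topologicalType} {n : nat}.
Variable M : charted R T n.

Definition manifold :=
  [/\ hausdorff_space T, @second_countable T,
      forall c, atlas M c -> is_chart c,
      forall p, atlas M (chart_at M p) /\ cdom (chart_at M p) p
    & forall c d, atlas M c -> atlas M d ->
        smooth_on (c @` (cdom c `&` cdom d)) (d \o cinv c)].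

Definition smooth_fun (f : T -> R) :=
  forall c, atlas M c -> smooth_on (ccodom c) (f \o cinv c : 'rV[R]_n -> R^o).

Definition dfun (f : T -> R) (p : T) : 'rV[R]_n :=
  let c := chart_at M p in
  \row_i 'd (f \o cinv c : 'rV[R]_n -> R^o) (c p) (delta_mx 0 i).

(* V(f) for a vector field V *)
Definition vf_apply (V : T -> 'rV[R]_n) (f : T -> R) (p : T) : R :=
  pairing (dfun f p) (V p).

(* Components in the chart [c] of a vector field, of a bivector field and of a
   field of n-linear forms; the rows of [A] are the n arguments of the form. *)
Definition vf_in (c : chart R T n) (V : T -> 'rV[R]_n) (x : 'rV[R]_n) :=
  let p := cinv c x in V p *m chart_change (chart_at M p) c p.

Definition bivector_in (c : chart R T n) (P : T -> 'M[R]_n) (x : 'rV[R]_n) :=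
  let p := cinv c x in
  let J := chart_change (chart_at M p) c p in J^T *m P p *m J.

Definition form_in (c : chart R T n) (nu : T -> 'M[R]_n -> R)
    (x : 'rV[R]_n) (A : 'M[R]_n) : R :=
  let p := cinv c x in nu p (A *m chart_change c (chart_at M p) p).

Definition smooth_vf_on (U : set T) (V : T -> 'rV[R]_n) :=
  forall c, atlas M c -> smooth_on (c @` (cdom c `&` U)) (vf_in c V).

Definition smooth_bivector (P : T -> 'M[R]_n) :=
  forall c, atlas M c -> smooth_on (ccodom c) (bivector_in c P).

Definition poisson_bracket (P : T -> 'M[R]_n) (f g : T -> R) (p : T) : R :=
  bilin (P p) (dfun f p) (dfun g p).

Definition poisson_structure (P : T -> 'M[R]_n) :=
  [/\ forall p, (P p)^T = - P p,
      smooth_bivector P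
    & forall f g h, smooth_fun f -> smooth_fun g -> smooth_fun h ->
        let br := poisson_bracket P in
        forall p, br f (br g h) p + br g (br h f) p + br h (br f g) p = 0].

(* X_h = i_{dh} P, i.e. eta(X_h) = P(dh, eta) *)
Definition hamiltonian_vf (P : T -> 'M[R]_n) (h : T -> R) (p : T) : 'rV[R]_n :=
  dfun h p *m P p.

(* [V, P] = L_V P at [p]: in local coordinates,
   [V, P]^ij = V^k d_k P^ij - P^kj d_k V^i - P^ik d_k V^j. *)
Definition schouten_vf_bivector (V : T -> 'rV[R]_n) (P : T -> 'M[R]_n) (p : T) :
    'M[R]_n :=
  let c := chart_at M p in
  let DV := jacobian (vf_in c V) (c p) in
  'd (bivector_in c P) (c p) (vf_in c V (c p))
  - DV^T *m bivector_in c P (c p) - bivector_in c P (c p) *m DV.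

Definition volume_form (nu : T -> 'M[R]_n -> R) :=
  [/\ forall p (A B C : 'M[R]_n) i b c,
        row i A = b *: row i B + c *: row i C ->
        row' i B = row' i A -> row' i C = row' i A ->
        nu p A = b * nu p B + c * nu p C,
      forall p (A : 'M[R]_n) i j, i != j -> row i A = row j A -> nu p A = 0,
      forall c, atlas M c -> forall A,
        smooth_on (ccodom c) (form_in c nu ^~ A : 'rV[R]_n -> R^o)
    & forall p, exists A, nu p A != 0].

(* L_V nu in the chart [c], at the point of coordinates [x], on the constant
   vector fields given by the rows of [A]:
   V(nu(A_1, .., A_n)) - \sum_i nu(A_1, .., [V, A_i], .., A_n),
   where [V, A_i] = - d_{A_i} V. *)
Definition lie_form_in (c : chart R T n) (V : T -> 'rV[R]_n)
    (nu : T -> 'M[R]_n -> R) (x : 'rV[R]_n) (A : 'M[R]_n) : R :=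
  let DV := jacobian (vf_in c V) x in
  'd (form_in c nu ^~ A : 'rV[R]_n -> R^o) x (vf_in c V x)
  + \sum_i form_in c nu x
      (\matrix_j (if j == i then row i A *m DV else row j A)).

(* L_V nu = 0 *)
Definition preserves_form (V : T -> 'rV[R]_n) (nu : T -> 'M[R]_n -> R) :=
  forall c, atlas M c -> forall x, ccodom c x -> forall A,
    lie_form_in c V nu x A = 0.

(* Meaningful when dh(p) = 0, for otherwise no [B] satisfies it (if n > 0). *)
Definition hessian_at (h : T -> R) (p : T) (B : 'M[R]_n) :=
  forall (U : set T) (V : T -> 'rV[R]_n), open U -> U p -> smooth_vf_on U V ->
  forall X : 'rV[R]_n, pairing (dfun (vf_apply V h) p) X = bilin B X (V p).

Definition morse_at (h : T -> R) (p : T) :=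
  dfun h p = 0 /\
  exists2 B : 'M[R]_n, hessian_at h p B &
    forall X, (forall Y, bilin B X Y = 0) -> X = 0.

End manifolds.

Section maps.
Context {R : realType} {S T : topologicalType} {m n : nat}.
Variables (M : charted R S m) (N : charted R T n).

Definition smooth_map (f : S -> T) :=
  continuous f /\
  forall c d, atlas M c -> atlas N d ->
    smooth_on (c @` (cdom c `&` f @^-1` cdom d)) (d \o f \o cinv c).

(* The differential of [f] at [p] is [v |-> v *m tangent_map f p]. *)
Definition tangent_map (f : S -> T) (p : S) : 'M[R]_(m, n) :=
  jacobian (chart_at N (f p) \o f \o cinv (chart_at M p)) (chart_at M p p).

Definition immersion f := smooth_map f /\ forall p, row_free (tangent_map f p).

Definition submersion f := smooth_map f /\ forall p, row_full (tangent_map f p).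

Definition poisson_map (P : S -> 'M[R]_m) (Q : T -> 'M[R]_n) (f : S -> T) :=
  smooth_map f /\
  forall p, (tangent_map f p)^T *m P p *m tangent_map f p = Q (f p).

Definition chart_prod (c : chart R S m) (d : chart R T n) :
    chart R (S * T)%type (m + n) :=
  Chart (cdom c `*` cdom d) (fun p => row_mx (c p.1) (d p.2))
    (fun x => (cinv c (lsubmx x), cinv d (rsubmx x))).

Definition charted_prod : charted R (S * T)%type (m + n) :=
  Charted [set e | exists2 c, atlas M c & exists2 d, atlas N d &
                     e = chart_prod c d]
    (fun p => chart_prod (chart_at M p.1) (chart_at N p.2)).

Definition bivector_prod (P : S -> 'M[R]_m) (Q : T -> 'M[R]_n)
    (p : S * T) : 'M[R]_(m + n) := block_mx (P p.1) 0 0 (Q p.2).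

End maps.

Section lie_groups.
Context {R : realType} {G : groupTopType} {n : nat}.
Variable MG : charted R G n.

Definition lie_group :=
  [/\ manifold MG,
      smooth_map (charted_prod MG MG) MG (fun x => (x.1 * x.2)%g)
    & smooth_map MG MG (fun x => (x^-1)%g)].

Definition poisson_lie_group (P : G -> 'M[R]_n) :=
  [/\ lie_group, poisson_structure MG P
    & poisson_map (charted_prod MG MG) MG (bivector_prod P P) P
        (fun x => (x.1 * x.2)%g)].

(* In what follows the Lie algebra of G is the tangent space at 1, and its dual
   consists of the covectors at 1. *)
Definition left_invariant_vf (X : 'rV[R]_n) (g : G) : 'rV[R]_n :=
  X *m tangent_map MG MG (fun x => (g * x)%g) 1%g.

Definition cobracket (P : G -> 'M[R]_n) (X : 'rV[R]_n) : 'M[R]_n :=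
  schouten_vf_bivector MG (left_invariant_vf X) P 1%g.

(* The linear form X |-> cobracket P X (xi, eta), by its values on the basis. *)
Definition dual_bracket (P : G -> 'M[R]_n) (xi eta : 'rV[R]_n) : 'rV[R]_n :=
  \row_i bilin (cobracket P (delta_mx 0 i)) xi eta.

End lie_groups.

(* Tr(ad_x) = 0 on K for all x in K, where K is the row space of a matrix,
   assumed to be stable under the Lie bracket [br].  [restrictmx] is the matrix
   of ad_x : K -> K in the basis [row_base K]. *)
Definition unimodular (R : realType) m n (br : 'rV[R]_n -> 'rV[R]_n -> 'rV[R]_n)
    (K : 'M[R]_(m, n)) :=
  forall x : 'rV[R]_n, (x <= K)%MS ->
    \tr (restrictmx K (lin1_mx (br x))) = 0.

(* A Lie subgroup is the image of an injective immersive morphism [i : H -> G].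
   G/H is the set of left cosets gH with the quotient topology. *)
Section coset_space.
Context {G H : groupTopType}.
Variable i : UMagmaMorphism.type H G.
Local Open Scope quotient_scope.

Definition coset_rel : rel G := fun x y => `[< range i (x^-1 * y)%g >].

Lemma coset_rel_refl : reflexive coset_rel.
Proof. by move=> x; apply/asboolP; exists 1%g => //; rewrite gmulf1 mulVg. Qed.

Lemma coset_rel_sym : symmetric coset_rel.
Proof.
suff s x y : coset_rel x y -> coset_rel y x by move=> x y; apply/idP/idP; exact: s.
move=> /asboolP[h _ ih]; apply/asboolP; exists (h^-1)%g => //.
by rewrite gmulfV ih invgM invgK.
Qed.

Lemma coset_rel_trans : transitive coset_rel.
Proof.
move=> y x z /asboolP[h _ ih] /asboolP[k _ ik]; apply/asboolP.
by exists (h * k)%g => //; rewrite gmulfM ih ik mulgA -(mulgA _ y) mulgV mulg1.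
Qed.

Definition coset_equiv : equiv_rel G :=
  EquivRel coset_rel coset_rel_refl coset_rel_sym coset_rel_trans.

Definition coset_space := quotient_topology {eq_quot coset_equiv}.

Definition coset_proj (g : G) : coset_space := \pi g.

Definition coset_act (x : G * coset_space) : coset_space :=
  coset_proj (x.1 * repr x.2)%g.

End coset_space.

Section homogeneous_spaces.
Context {R : realType} {G H : groupTopType} {n k m : nat}.
Variables (MG : charted R G n) (MH : charted R H k).
Variable i : UMagmaMorphism.type H G.
Variable M : charted R (coset_space i) m.

Definition closed_connected_lie_subgroup :=
  [/\ lie_group MH, connected [set: H], immersion MH MG i, injective i
    & closed (range i)].

(* The smooth structure of G/H is the only one for which the projection is a
   submersion, and dim G/H = dim G - dim H. *)
Definition homogeneous_manifold :=
  [/\ manifold M, submersion MG M (coset_proj i) & dimension MG = (dimension MH + dimension M)%N].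

Definition coisotropic_poisson (PG : G -> 'M[R]_n)
    (P : coset_space i -> 'M[R]_m) :=
  [/\ poisson_structure M P,
      poisson_map (charted_prod MG M) M (bivector_prod PG P) P (@coset_act G H i)
    & poisson_map MG M PG P (coset_proj i)].

(* Its rows span the annihilator of the Lie algebra of H, which is the row space
   of the differential of [i] at 1. *)
Definition lie_annihilator : 'M[R]_n := kermx (tangent_map MH MG i 1%g)^T.

End homogeneous_spaces.

(* Main.v *)
Require Import Defs.
From HB Require Import structures.
From mathcomp Require Import all_boot all_order all_algebra generic_quotient.
From mathcomp Require Import all_classical all_reals all_analysis.
From mathcomp Require Import ring lra.

(** In local coordinates around o = eH, let f be the density of the volume form
    and A the matrix of the Poisson tensor.  That X_h preserves the form reads
      (d f)(X_h) + f * sum_ij (d_j d_i h A^ij + d_i h d_j A^ij) = 0.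
    Multiplicativity gives Pi_G(e) = 0, hence A(o) = 0, and dh(o) = 0.  So all
    terms vanish to first order at o, and differentiating once along d_k leaves
      f(o) * sum_i d_k d_i h(o) * (sum_j d_j A^ij(o)) = 0,
    the other second-order term, sum_ij d_j d_i h(o) d_k A^ij(o), pairing a
    symmetric matrix with an antisymmetric one.  Nondegeneracy of the Hessian
    gives sum_j d_j A^ij(o) = 0 for every i, i.e. the linearized bracket
    [dx^i, dx^j] = d_l A^ij(o) dx^l on T*_o(G/H) is unimodular.  Finally the
    transpose of T_e q is an isomorphism from this Lie algebra onto h^0, because
    q is Poisson and both bivectors vanish at the base points. *)

Set Implicit Arguments.
Unset Strict Implicit.
Unset Printing Implicit Defensive.
Import Order.TTheory GRing.Theory Num.Theory.
Import numFieldNormedType.Exports.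
Local Open Scope classical_set_scope.
Local Open Scope ring_scope.

(** * Differentials and C^k functions *)

(* Sealed, like [pd] and [transition] below: comparing two differentials up to
   conversion unfolds the choice operator behind ['d] and practically diverges. *)
HB.lock Definition jac (R : realType) n m (f : 'rV[R]_n -> 'rV[R]_m)
  (x : 'rV[R]_n) : 'M[R]_(n, m) := jacobian f x.

Lemma mul_jac (R : realType) n m (f : 'rV[R]_n -> 'rV[R]_m) (x v : 'rV[R]_n) :
  v *m jac f x = 'd f x v.
Proof. by rewrite jac.unlock /jacobian mul_rV_lin1. Qed.

Section near_eq.
Context {R : realType} {V W : normedModType R}.
Implicit Types f g : V -> W.

(** The zero map is a first-order expansion, and uniqueness of such expansions identifies it with
    ['d f x]. This is the case from which locality of differentiability follows, on writing g = f +
    (g - f). *)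
Lemma differentiable_near0 f x : {near x, f =1 (fun=> 0)} -> differentiable f x.
Proof.
move=> f0.
have f_o : f \o shift x = cst (f x) + (\0 : {linear V -> W}) +o_ 0 id.
  apply/eqaddoP => _/posnumP[e]; near=> y.
  rewrite /= !fctE /= (nbhs_singleton f0) addr0 subr0.
  rewrite (_ : f (y + x) = 0) ?normr0 ?mulr_ge0//.
  near: y; move: f0; rewrite (near_shift 0 x)/=.
  by apply: filterS => y; rewrite subr0.
have d0 : 'd f x = (\0 : {linear V -> W}) :> (V -> W).
  by apply: diff_unique => //; exact: cst_continuous.
by apply/diff_locallyP; split; rewrite d0//; exact: cst_continuous.
Unshelve. all: by end_near. Qed.

Lemma near_eq_differentiable f g x :
  {near x, f =1 g} -> differentiable f x -> differentiable g x.
Proof.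
move=> fg df; rewrite (_ : g = f + (g - f)); last by rewrite addrC subrK.
apply: differentiableD => //; apply: differentiable_near0.
by apply: filterS fg => y fgy; rewrite !fctE fgy subrr.
Qed.

Lemma near_eq_diff f g x v :
  {near x, f =1 g} -> differentiable f x -> 'd f x v = 'd g x v.
Proof.
move=> fg df; rewrite -!deriveE//; first exact: near_eq_derive.
exact: near_eq_differentiable df.
Qed.

End near_eq.

Section jacobians.
Context {R : realType}.

Lemma eq_mulmx_row n m (A B : 'M[R]_(n, m)) :
  (forall v : 'rV[R]_n, v *m A = v *m B) -> A = B.
Proof. by move=> AB; apply/row_matrixP => i; rewrite (rowE i A) (rowE i B). Qed.

Lemma jac_comp n m p (f : 'rV[R]_n -> 'rV[R]_m) (g : 'rV[R]_m -> 'rV[R]_p) x :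
  differentiable f x -> differentiable g (f x) ->
  jac (g \o f) x = jac f x *m jac g (f x).
Proof.
move=> df dg; apply: eq_mulmx_row => v.
by rewrite mulmxA !mul_jac (diff_comp df dg).
Qed.

Lemma near_eq_jac n m (f g : 'rV[R]_n -> 'rV[R]_m) (x : 'rV[R]_n) :
  {near x, f =1 g} -> differentiable f x -> jac f x = jac g x.
Proof.
move=> fg df; apply: eq_mulmx_row => v.
by rewrite !mul_jac; exact: (near_eq_diff v fg df).
Qed.

Lemma jac_id n (x : 'rV[R]_n) : jac id x = 1%:M.
Proof.
by apply: eq_mulmx_row => v; rewrite mulmx1 mul_jac diff_val.
Qed.

Lemma jac_cst n m (a : 'rV[R]_m) (x : 'rV[R]_n) : jac (cst a) x = 0.
Proof.
by apply: eq_mulmx_row => v; rewrite mulmx0 mul_jac diff_cst.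
Qed.

End jacobians.

Section Ck_algebra.
Context {R : realType} {V : normedModType R}.
Implicit Types (U : set V) (k : nat).

Lemma CkW {W : normedModType R} k U (f : V -> W) : Ck k.+1 U f -> Ck k U f.
Proof.
elim: k f => [f [df _] x Ux|k IH f [df df']].
  exact/differentiable_continuous/df.
by split=> // v; apply: IH.
Qed.

Lemma Ck_ext {W : normedModType R} k U (f g : V -> W) : open U ->
  (forall x, U x -> f x = g x) -> Ck k U f -> Ck k U g.
Proof.
move=> oU; elim: k f g => [|k IH] f g fg.
  have nfg x : U x -> {near x, f =1 g}.
    by move=> Ux; near=> y; apply: fg; near: y; exact: open_nbhs_nbhs.
  move=> cf x Ux; rewrite /prop_for/continuous_at -(fg _ Ux).
  have := cf x Ux; apply: cvg_trans; apply: near_eq_cvg.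
  by apply: filterS (nfg x Ux).
have nfg x : U x -> {near x, f =1 g}.
  by move=> Ux; near=> y; apply: fg; near: y; exact: open_nbhs_nbhs.
move=> [df df']; split=> [x Ux|v].
  by apply: near_eq_differentiable (df x Ux); exact: nfg.
apply: IH (df' v) => x Ux; apply: near_eq_diff (df x Ux); exact: nfg.
Unshelve. all: by end_near. Qed.

Lemma Ck_cst {W : normedModType R} k U (a : W) : Ck k U (cst a).
Proof.
elim: k a => [|k IH] a; first by move=> x _; exact: cst_continuous.
split=> [x _|v]; first exact: differentiable_cst.
rewrite (_ : (fun x => _) = cst 0)//.
by apply/funext => x; rewrite diff_cst.
Qed.

Lemma Ck_lin {W W' : normedModType R} (l : {linear W -> W'}) k U (f : V -> W) :
  continuous l -> open U -> Ck k U f -> Ck k U (l \o f).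
Proof.
move=> cl oU; have dl y : differentiable l y by exact: linear_differentiable.
elim: k f => [f cf x Ux|k IH f [df df']].
  by apply: continuous_comp; [exact: cf|exact: cl].
split=> [x Ux|v]; first exact: differentiable_comp (df x Ux) (dl _).
apply: Ck_ext (IH _ (df' v)) => // x Ux.
by rewrite diff_comp ?diff_lin//; exact: df.
Qed.

Lemma CkD {W : normedModType R} k U (f g : V -> W) : open U ->
  Ck k U f -> Ck k U g -> Ck k U (f + g).
Proof.
move=> oU; elim: k f g => [f g cf cg x Ux|k IH f g [df df'] [dg dg']].
  by apply: continuousD; [exact: cf|exact: cg].
split=> [x Ux|v]; first exact: differentiableD (df x Ux) (dg x Ux).
apply: Ck_ext (IH _ _ (df' v) (dg' v)) => // x Ux.
by rewrite diffD//; [exact: df|exact: dg].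
Qed.

Lemma Ck_sum {W : normedModType R} (I : finType) k U (f : I -> V -> W) :
  open U -> (forall i, Ck k U (f i)) -> Ck k U (fun x => \sum_i f i x).
Proof.
move=> oU cf; rewrite (_ : (fun x => _) = \sum_i f i); last first.
  by apply/funext => x; rewrite fct_sumE.
elim/big_ind : _ => [|g h cg ch|i _]; [exact: Ck_cst|exact: CkD|exact: cf].
Qed.

(** Leibniz: the derivative along [v] is a sum of products of one differentiated and one
    undifferentiated factor; [CkW] lowers the order of the latter so that the induction hypothesis
    applies. *)
Lemma CkM k U (f g : V -> R^o) : open U ->
  Ck k U f -> Ck k U g -> Ck k U (f * g : V -> R^o).
Proof.
move=> oU; elim: k f g => [f g cf cg x Ux|k IH f g].
  by apply: (@continuousM R V f g x); [exact: cf|exact: cg].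
move=> Cf Cg; have cf := CkW Cf; have cg := CkW Cg.
move: Cf Cg => [df df'] [dg dg'].
split=> [x Ux|v]; first exact: (differentiableM (df x Ux) (dg x Ux)).
apply: Ck_ext (CkD oU (IH _ _ cf (dg' v)) (IH _ _ cg (df' v))) => // x Ux.
by rewrite (@diffM R V f g x)//; [exact: df|exact: dg].
Qed.

Lemma Ck_coord m n k U (f : V -> 'M[R]_(m, n)) i j : open U -> Ck k U f ->
  Ck k U (fun x => f x i j : R^o).
Proof.
move=> oU.
have @l : {linear 'M[R]_(m, n) -> R^o}.
  by exists (fun N : 'M[R]_(_, _) => N i j); do 2![eexists]; do ?[constructor];
     rewrite ?mxE// => ? *; rewrite ?mxE//; move=> ?; rewrite !mxE.
by apply: (@Ck_lin _ _ l) => //; exact: coord_continuous.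
Qed.

Lemma Ck_row n k U (f : 'I_n -> V -> R^o) : open U ->
  (forall i, Ck k U (f i)) -> Ck k U (fun x => \row_i f i x).
Proof.
move=> oU cf.
rewrite (_ : (fun x => _) =
    fun x => \sum_i (( *:%R ^~ (delta_mx 0 i : 'rV[R]_n)) \o f i) x); last first.
  by apply/funext => x; rewrite [LHS]row_sum_delta; apply: eq_bigr => i _; rewrite mxE.
apply: Ck_sum => // i.
have sx_lin : linear ( *:%R ^~ (delta_mx 0 i) : R^o -> 'rV[R]_n).
  by move=> a u v; rewrite scalerDl scalerA.
pose sxlM := GRing.isLinear.Build _ _ _ _ _ sx_lin.
pose sxL : {linear _ -> _} :=
  HB.pack ( *:%R ^~ (delta_mx 0 i) : R^o -> 'rV[R]_n) sxlM.
apply: (@Ck_lin _ _ sxL) => //; exact: scalel_continuous.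
Qed.

End Ck_algebra.

Section Ck_composition.
Context {R : realType} {V : normedModType R} {n : nat}.

Lemma diff_delta {W : normedModType R} (g : 'rV[R]_n -> W) y (v : 'rV[R]_n) :
  'd g y v = \sum_i v 0 i *: 'd g y (delta_mx 0 i).
Proof.
by rewrite {1}[v]row_sum_delta linear_sum; apply: eq_bigr => i _; rewrite linearZ.
Qed.

(** The derivative along [v] is ['d g] at a moving point applied to a moving vector. Expanding that
    vector in the standard basis decouples the two dependences: each summand is a coordinate of
    ['d f x v] times a partial derivative of [g] composed with [f], and the induction hypothesis
    covers the latter. *)
Lemma Ck_comp k (U : set V) (U' : set 'rV[R]_n) (f : V -> 'rV[R]_n)
    (g : 'rV[R]_n -> R^o) : open U -> (forall x, U x -> U' (f x)) ->
  Ck k U f -> Ck k U' g -> Ck k U (g \o f).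
Proof.
move=> oU UU'; elim: k g => [g cf cg x Ux|k IH g].
  by apply: continuous_comp; [exact: cf|exact/cg/UU'].
move=> Cf [dg dg']; have cf := CkW Cf; case: (Cf) => df df'.
split=> [x Ux|v]; first exact: differentiable_comp (df x Ux) (dg _ (UU' x Ux)).
apply: (@Ck_ext _ _ _ _ _ (fun x => \sum_i
    ((fun x => 'd f x v 0 i : R^o) *
    ((fun y => 'd g y (delta_mx 0 i)) \o f)) x)) => //.
  move=> x Ux; rewrite diff_comp; [|exact: df|exact/dg/UU'].
  by rewrite /= [RHS]diff_delta.
apply: Ck_sum => // i; apply: CkM => //.
  exact: (Ck_coord 0 i oU (df' v)).
exact: (IH _ cf (dg' _)).
Qed.

Lemma smooth_on_comp p (U : set V) (U' : set 'rV[R]_n) (f : V -> 'rV[R]_n)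
    (g : 'rV[R]_n -> 'rV[R]_p) : open U -> open U' ->
    (forall x, U x -> U' (f x)) ->
  smooth_on U f -> smooth_on U' g -> smooth_on U (g \o f).
Proof.
move=> oU oU' UU' cf cg k.
rewrite (_ : g \o f = fun x => \row_i ((fun y => g y 0 i : R^o) \o f) x).
  apply: Ck_row => // i.
  exact: (Ck_comp (g := fun y => g y 0 i : R^o) oU UU' (cf k)
    (Ck_coord 0 i oU' (cg k))).
by apply/funext => x; apply/rowP => i; rewrite mxE.
Qed.

End Ck_composition.

(** * Symmetry of second derivatives *)

Section second_derivatives.
Context {R : realType} {V : normedModType R}.
Implicit Types f : V -> R^o.

Lemma is_derive_line f (a u : V) (s : R) : differentiable f (s *: u + a) ->
  is_derive s 1 (fun r : R => f (r *: u + a)) ('d f (s *: u + a) u).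
Proof.
move=> df; have dk : differentiable (fun r : R => r *: u) s.
  exact: (differentiableZl (k := id)).
have da : differentiable (cst a : R -> V) s by exact: differentiable_cst.
have dl : 'd ((fun r : R => r *: u) + cst a) s 1 = u.
  rewrite (diffD dk da) /= [X in X + _](_ : _ = u).
    by rewrite !fctE (diff_cst a s) addr0.
  by rewrite (diffZl (k := id) u)//= diff_val scale1r.
have dfl := differentiable_comp (differentiableD dk da) df.
have -> : (fun r : R => f (r *: u + a)) =
    f \o ((fun r : R => r *: u) + cst a) by [].
apply: DeriveDef; first by apply: diff_derivable; exact: dfl.
by rewrite (deriveE _ dfl) (diff_comp (differentiableD dk da) df) /= dl.
Qed.

(* Mean value theorem along [u], then first-order expansion of the derivative
   along [u] at [x]. *)
Lemma second_difference f (x u v : V) :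
  (\forall y \near x, differentiable f y) ->
  differentiable (fun y => 'd f y u : R^o) x ->
  forall e, 0 < e -> \forall t \near 0^'+,
    `|f (t *: u + (t *: v + x)) - f (t *: u + x) - (f (t *: v + x) - f x)
      - t ^+ 2 * 'd (fun y => 'd f y u : R^o) x v| <= e * t ^+ 2.
Proof.
move=> df; set g := fun y => _ => dg e e0.
(* The points s u + t v and s u with 0 <= s <= t have norms adding up to at most 2 N t, whence the
   tolerance e / (2 N) below. The summand 1 keeps N positive when u = v = 0. *)
set N := `|u| + `|v| + 1.
have N0 : 0 < N by rewrite ltr_wpDl// addr_ge0.
have e'0 : 0 < e / (2 * N) by rewrite divr_gt0// mulr_gt0.
have [r r0 rP] : exists2 r : R, 0 < r & forall y, `|y| < r ->
    differentiable f (y + x) /\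
    `|g (y + x) - g x - 'd g x y| <= e / (2 * N) * `|y|.
  have : \forall y \near 0, differentiable f (y + x) /\
    `|g (y + x) - g x - 'd g x y| <= e / (2 * N) * `|y|.
    apply: filterI; first by move: df; rewrite (near_shift 0 x)/=;
      apply: filterS => y; rewrite /= subr0.
    have /eqaddoP/(_ _ e'0) := diff_locally dg.
    by apply: filterS => y; rewrite !fctE /= opprD addrA.
  move=> /nbhs_ballP[r r0 rP]; exists r => // y yr; apply: rP.
  by rewrite -ball_normE/= sub0r normrN.
have small s t : 0 <= s <= t -> t < r / N -> `|s *: u + t *: v| < r /\
    `|s *: u| < r /\ `|s *: u| + `|s *: u + t *: v| <= 2 * N * t.
  move=> /andP[s0 st]; rewrite ltr_pdivlMr// => tr.
  have t0 : 0 <= t by apply: le_trans st.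
  have su : `|s *: u| <= t * `|u| by rewrite normrZ ger0_norm// ler_wpM2r.
  have sutv : `|s *: u + t *: v| <= t * `|u| + t * `|v|.
    by rewrite (le_trans (ler_normD _ _))// lerD// normrZ ger0_norm.
  have := mulr_ge0 t0 (normr_ge0 u); have := mulr_ge0 t0 (normr_ge0 v).
  rewrite /N in tr *.
  by move=> ? ?; split; [|split]; lra.
near=> t.
have t0 : 0 < t by near: t; exact: nbhs_right_gt.
have tr : t < r / N by near: t; apply: nbhs_right_lt; exact: divr_gt0.
(* The second difference is [phi t - phi 0], and [dphi] is the derivative of [phi]. *)
pose phi s : R := f (s *: u + (t *: v + x)) - f (s *: u + x).
pose dphi s : R := g (s *: u + (t *: v + x)) - g (s *: u + x).
have dphiE s : 0 <= s <= t -> is_derive s 1 phi (dphi s).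
  move=> st; have [h1 [h2 _]] := small _ _ st tr.
  apply: is_deriveB; apply: is_derive_line.
    by rewrite addrA; have [] := rP _ h1.
  by have [] := rP _ h2.
have [s] : exists2 s, s \in `]0, t[%R & phi t - phi 0 = dphi s * (t - 0).
  apply: MVT => // [s|].
    by rewrite in_itv/= => /andP[s0 st]; apply: dphiE; rewrite !ltW.
  apply: derivable_within_continuous => s; rewrite in_itv/= => st.
  by have [] := dphiE s st.
rewrite in_itv/= => /andP[s0 st].
rewrite /phi !scale0r !add0r subr0 => ->.
have [|h1 [h2 h3]] := small s t _ tr; first by rewrite !ltW.
have [_ g1] := rP _ h1; have [_ g2] := rP _ h2.
(* By linearity the main term is the difference of the linear parts of [g] at the two points, so the
   error is the difference of two remainders already bounded. *)
have dE : t * 'd g x v = 'd g x (s *: u + t *: v) - 'd g x (s *: u).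
  by rewrite -linearB addrAC subrr add0r linearZ.
rewrite expr2 -mulrA dE (mulrC (dphi s)) -mulrBr normrM (gtr0_norm t0).
rewrite mulrCA ler_pM2l// /dphi addrA.
set G1 := g (_ + _ + x) in g1 *; set G2 := g (_ + x) in g2 *.
set D1 := 'd g x _ in g1 *; set D2 := 'd g x _ in g2 *.
have -> : G1 - G2 - (D1 - D2) = (G1 - g x - D1) - (G2 - g x - D2).
  by rewrite !opprB; ring.
rewrite (le_trans (ler_normB _ _))// (le_trans (lerD g1 g2))//.
rewrite -mulrDr mulrAC ler_pdivrMr ?mulr_gt0// -mulrA ler_pM2l//.
by rewrite addrC (mulrC t).
Unshelve. all: by end_near. Qed.

(** The second difference is symmetric in [u] and [v], and divided by t^2 it tends to either
    iterated derivative as t tends to 0 from the right. *)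
Lemma diff_comm f (x u v : V) :
  (\forall y \near x, differentiable f y) ->
  differentiable (fun y => 'd f y u : R^o) x ->
  differentiable (fun y => 'd f y v : R^o) x ->
  'd (fun y => 'd f y u : R^o) x v = 'd (fun y => 'd f y v : R^o) x u.
Proof.
move=> df du dv; apply/eqP; rewrite -subr_eq0 -normr_le0.
apply/ler_addgt0Pr => e e0; rewrite add0r.
have e2 : 0 < e / 2 by rewrite divr_gt0.
near (0 : R)^'+ => t.
have t0 : 0 < t by near: t; exact: nbhs_right_gt.
have h1 : `|f (t *: u + (t *: v + x)) - f (t *: u + x) - (f (t *: v + x) - f x)
      - t ^+ 2 * 'd (fun y => 'd f y u : R^o) x v| <= e / 2 * t ^+ 2.
  by near: t; exact: second_difference.
have h2 : `|f (t *: v + (t *: u + x)) - f (t *: v + x) - (f (t *: u + x) - f x)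
      - t ^+ 2 * 'd (fun y => 'd f y v : R^o) x u| <= e / 2 * t ^+ 2.
  by near: t; exact: second_difference.
have t2 : 0 < t ^+ 2 by rewrite exprn_gt0.
(* Both estimates now contain the same corner value f(x + t u + t v), which cancels. *)
rewrite addrCA in h2.
set Du := 'd _ x v in h1 *; set Dv := 'd _ x u in h2 *.
move: h1 h2; set a := f (_ + _); set b := f (_ + x); set c := f (_ + x).
move=> h1 h2; rewrite -(ler_pM2l t2) -{1}(gtr0_norm t2) -normrM.
rewrite (_ : t ^+ 2 * (Du - Dv) =
  (a - c - (b - f x) - t ^+ 2 * Dv) - (a - b - (c - f x) - t ^+ 2 * Du)); last ring.
by rewrite (le_trans (ler_normB _ _))// (le_trans (lerD h2 h1))// -mulrDl -splitr mulrC.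
Unshelve. all: by end_near. Qed.

End second_derivatives.

(** * Partial derivatives and charts *)

HB.lock Definition pd (R : realType) n (f : 'rV[R]_n -> R^o) (i : 'I_n)
  (x : 'rV[R]_n) : R^o := 'd f x (delta_mx 0 i).

Definition grad (R : realType) n (f : 'rV[R]_n -> R^o) (x : 'rV[R]_n) : 'rV[R]_n :=
  \row_i pd f i x.

Section partial_derivatives.
Context {R : realType} {n : nat}.
Implicit Types (f g : 'rV[R]_n -> R^o) (x : 'rV[R]_n) (U : set 'rV[R]_n).

Lemma diff_pd f x (v : 'rV[R]_n) : 'd f x v = \sum_i v 0 i * pd f i x.
Proof. by rewrite pd.unlock [LHS]diff_delta. Qed.

Lemma diff_grad f x (v : 'rV[R]_n) : 'd f x v = (v *m (grad f x)^T) 0 0.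
Proof. by rewrite diff_pd mxE; apply: eq_bigr => i _; rewrite !mxE. Qed.

Lemma near_eq_pd f g i x : {near x, f =1 g} -> differentiable f x ->
  pd f i x = pd g i x.
Proof. by move=> fg df; rewrite pd.unlock; exact: near_eq_diff. Qed.

Lemma pdM f g i x : differentiable f x -> differentiable g x ->
  pd (fun y => f y * g y) i x = pd f i x * g x + f x * pd g i x.
Proof.
move=> df dg; rewrite pd.unlock.
have /(congr1 (@^~ (delta_mx 0 i))) E := @diffM R _ f g x df dg.
by apply: etrans E _; rewrite /= addrC mulrC.
Qed.

Lemma pdD f g i x : differentiable f x -> differentiable g x ->
  pd (fun y => f y + g y) i x = pd f i x + pd g i x.
Proof.
move=> df dg; rewrite pd.unlock.
have /(congr1 (@^~ (delta_mx 0 i))) E := @diffD R _ _ f g x df dg.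
exact: etrans E _.
Qed.

Lemma pd_cst (a : R) i x : pd (fun=> a) i x = 0.
Proof. by rewrite pd.unlock (diff_cst (a : R^o)). Qed.

Lemma differentiable_fsum (I : Type) (s : seq I) (f : I -> 'rV[R]_n -> R^o) x :
  (forall k, differentiable (f k) x) ->
  differentiable (fun y => \sum_(k <- s) f k y : R^o) x.
Proof.
move=> df; elim: s => [|k s IH].
  under eq_fun do rewrite big_nil; exact: differentiable_cst.
under eq_fun do rewrite big_cons; exact: differentiableD (df k) IH.
Qed.

Lemma pd_sum (I : Type) (s : seq I) (f : I -> 'rV[R]_n -> R^o) i x :
  (forall k, differentiable (f k) x) ->
  pd (fun y => \sum_(k <- s) f k y) i x = \sum_(k <- s) pd (f k) i x.
Proof.
move=> df; elim: s => [|k s IH].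
  under eq_fun do rewrite big_nil; by rewrite big_nil pd_cst.
under eq_fun do rewrite big_cons.
by rewrite big_cons -IH pdD//; exact: differentiable_fsum.
Qed.

Lemma pd_comm f i j x : (\forall y \near x, differentiable f y) ->
  differentiable (pd f i) x -> differentiable (pd f j) x ->
  pd (pd f i) j x = pd (pd f j) i x.
Proof.
move=> df di dj; have pdE k : pd f k = (fun y => 'd f y (delta_mx 0 k)).
  by apply/funext => y; rewrite pd.unlock.
by rewrite pdE in di; rewrite pdE in dj; rewrite !pdE pd.unlock; exact: diff_comm.
Qed.

Lemma differentiable_entry k m (F : 'rV[R]_n -> 'M[R]_(k, m)) x i j :
  differentiable F x -> differentiable (fun y => F y i j : R^o) x.
Proof.
move=> dF; apply: (differentiable_comp (g := fun N : 'M[R]_(k, m) => N i j : R^o) dF).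
exact: differentiable_coord.
Qed.

Lemma diff_entry k m (F : 'rV[R]_n -> 'M[R]_(k, m)) x i j (v : 'rV[R]_n) :
  differentiable F x -> 'd F x v i j = 'd (fun y => F y i j : R^o) x v.
Proof.
move=> dF; have dE := differentiable_entry i j dF.
rewrite -(deriveE _ dF) -(deriveE _ dE).
by rewrite (derive_mx (diff_derivable dF)) mxE.
Qed.

Lemma jacE m (F : 'rV[R]_n -> 'rV[R]_m) x i j : differentiable F x ->
  jac F x i j = pd (fun y => F y 0 j) i x.
Proof.
move=> dF; rewrite pd.unlock -diff_entry// -mul_jac -rowE mxE.
by [].
Qed.

End partial_derivatives.

Lemma grad_comp (R : realType) n m (g : 'rV[R]_n -> 'rV[R]_m) (f : 'rV[R]_m -> R^o)
    (x : 'rV[R]_n) :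
  differentiable g x -> differentiable f (g x) ->
  grad (f \o g) x = grad f (g x) *m (jac g x)^T.
Proof.
move=> dg df; apply/rowP => i; rewrite !mxE pd.unlock.
have /(congr1 (@^~ (delta_mx 0 i))) E := diff_comp dg df.
apply: etrans E _; apply: etrans (diff_grad _ _ _) _.
rewrite -mul_jac mxE.
by apply: eq_bigr => j _; rewrite mulrC -rowE !mxE.
Qed.

Section smooth_functions.
Context {R : realType} {n : nat}.
Implicit Types (f g : 'rV[R]_n -> R^o) (U : set 'rV[R]_n).

Lemma smooth_on_differentiable {V W : normedModType R} (U : set V) (F : V -> W) x :
  smooth_on U F -> U x -> differentiable F x.
Proof. by move=> /(_ 1)[dF _]; exact: dF. Qed.

Lemma smooth_on_diff {V W : normedModType R} (U : set V) (F : V -> W) v :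
  smooth_on U F -> smooth_on U (fun x => 'd F x v).
Proof. by move=> sF k; have [_ sF'] := sF k.+1; exact: sF'. Qed.

Lemma smooth_on_pd U f i : smooth_on U f -> smooth_on U (pd f i).
Proof. by rewrite pd.unlock; exact: smooth_on_diff. Qed.

Lemma smooth_on_entry {V : normedModType R} (U : set V) k m (F : V -> 'M[R]_(k, m))
  i j : open U -> smooth_on U F -> smooth_on U (fun x => F x i j : R^o).
Proof. by move=> oU sF l; exact: Ck_coord (sF l). Qed.

Lemma smooth_on_ext {V W : normedModType R} (U : set V) (F G : V -> W) : open U ->
  (forall x, U x -> F x = G x) -> smooth_on U F -> smooth_on U G.
Proof. by move=> oU FG sF k; exact: Ck_ext (sF k). Qed.

End smooth_functions.

Section chart_maps.
Context {R : realType}.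

(** Charts are total functions that mean something only on their domains. This provides the
    neighbourhood in coordinates on which the chart and its inverse cancel, as needed whenever two
    local expressions are compared. *)
Lemma chart_near {T : topologicalType} n (c : chart R T n) (p : T) (W : set T) :
  is_chart c -> cdom c p -> nbhs p W ->
  \forall x \near c p, [/\ ccodom c x, cdom c (cinv c x), W (cinv c x) &
    c (cinv c x) = x].
Proof.
move=> [oD oC cK cc ic] cp Wp.
have Cp : ccodom c (c p) by exists p.
have : nbhs (cinv c (c p)) (W `&` cdom c).
  by rewrite cK//; apply: filterI => //; exact: open_nbhs_nbhs.
move=> /(ic _ Cp); apply: filterS2 (open_nbhs_nbhs (conj oC Cp)) => x Cx [Wx Dx].
split=> //; case: Cx => q Dq <-; by rewrite cK.
Qed.

Lemma open_chart_image {T : topologicalType} n (c : chart R T n) (W : set T) :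
  is_chart c -> open W -> open (c @` (cdom c `&` W)).
Proof.
move=> hc oW; rewrite openE => _ [p [Dp Wp] <-].
have := chart_near hc Dp (open_nbhs_nbhs (conj oW Wp)).
by apply: filterS => x [_ Dx Wx cx]; exists (cinv c x).
Qed.

(** The chain rule for local representatives: the inner [cinv d] and [d] cancel only near the point,
    which is enough for the Jacobian. With [f] or [g] the identity it gives the change of charts in
    source or target. *)
Lemma jac_rep_comp {S T U : topologicalType} n m k (c : chart R S n)
    (d : chart R T m) (e : chart R U k) (f : S -> T) (g : T -> U) (p : S) :
  is_chart c -> is_chart d -> cdom c p -> cdom d (f p) -> {for p, continuous f} ->
  differentiable (d \o f \o cinv c) (c p) ->
  differentiable (e \o g \o cinv d) (d (f p)) ->
  jac (e \o (g \o f) \o cinv c) (c p) =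
  jac (d \o f \o cinv c) (c p) *m jac (e \o g \o cinv d) (d (f p)).
Proof.
move=> hc hd cp dfp cf df dg.
have cK : cinv c (c p) = p by case: hc => ? ? -> .
have ffp : (d \o f \o cinv c) (c p) = d (f p) by rewrite /= cK.
rewrite -ffp -jac_comp ?ffp//; apply/esym/near_eq_jac.
  have : nbhs p (f @^-1` cdom d).
    by apply: cf; apply: open_nbhs_nbhs; split => //; case: hd.
  move=> /(chart_near hc cp); apply: filterS => x [_ _ dfx _].
  by rewrite /=; case: hd => _ _ -> .
by apply: differentiable_comp => //; rewrite ffp.
Qed.

End chart_maps.

(** * Alternating forms and unimodularity *)

Section alternating_forms.
Context {F : fieldType} {n : nat}.
Variable phi : 'M[F]_n -> F.
Hypothesis phi_lin : forall (A B C : 'M[F]_n) i b c,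
  row i A = b *: row i B + c *: row i C ->
  row' i B = row' i A -> row' i C = row' i A -> phi A = b * phi B + c * phi C.
Hypothesis phi_alt : forall (A : 'M[F]_n) i j,
  i != j -> row i A = row j A -> phi A = 0.

(** With [v] equal to [row i A *m D], these are the matrices summed in [lie_form_in]. *)
Definition set_row (A : 'M[F]_n) i (v : 'rV[F]_n) : 'M[F]_n :=
  \matrix_j (if j == i then v else row j A).

Lemma row_set_row A i v : row i (set_row A i v) = v.
Proof. by rewrite rowK eqxx. Qed.

Lemma row'_set_row A i v w : row' i (set_row A i v) = row' i (set_row A i w).
Proof.
by apply/matrixP => j k; rewrite !mxE eq_sym (negbTE (neq_lift _ _)).
Qed.

Lemma phi_set_rowD A i v w (b : F) :
  phi (set_row A i (b *: v + w)) = b * phi (set_row A i v) + phi (set_row A i w).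
Proof.
rewrite -[phi (set_row A i w)]mul1r; apply: (phi_lin (i := i)).
- by rewrite !row_set_row scale1r.
- exact: row'_set_row.
- exact: row'_set_row.
Qed.

Lemma phi_set_row0 A i : phi (set_row A i 0) = 0.
Proof.
have := phi_set_rowD A i 0 0 1; rewrite scaler0 addr0 mul1r => /eqP.
by rewrite addrC -subr_eq subrr => /eqP.
Qed.

(** Cramer's rule: in the expansion of [w *m A] along the rows of [A], every row other than the i-th
    one produces a repeated row and contributes zero. *)
Lemma phi_set_rowM A i (w : 'rV[F]_n) : phi (set_row A i (w *m A)) = w 0 i * phi A.
Proof.
have phi_row j : phi (set_row A i (row j A)) = (j == i)%:R * phi A.
  have [->|ji] := eqVneq j i.
    rewrite mul1r; congr phi; apply/row_matrixP => k; rewrite rowK.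
    by case: eqP => [->|].
  by rewrite mul0r; apply: (phi_alt ji); rewrite !rowK eqxx (negbTE ji).
rewrite mulmx_sum_row.
transitivity (\sum_j w 0 j * phi (set_row A i (row j A))).
  elim: (index_enum _) => [|j s IH]; first by rewrite !big_nil phi_set_row0.
  by rewrite !big_cons phi_set_rowD IH.
rewrite (bigD1 i)//= phi_row eqxx mul1r big1 ?addr0// => j /negbTE ji.
by rewrite phi_row ji mul0r mulr0.
Qed.

(** If v A = 0, Cramer's rule gives v_i phi(A) = 0 for every i. *)
Lemma alternating_unitmx A : phi A != 0 -> A \in unitmx.
Proof.
move=> A0; rewrite -row_free_unit; apply: inj_row_free => v vA; apply/rowP => i.
have := phi_set_rowM A i v; rewrite vA phi_set_row0 mxE => /esym/eqP.
by rewrite mulf_eq0 (negbTE A0) orbF => /eqP.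
Qed.

(** The rows of [A] form a basis, in which right multiplication by [D] has the matrix A D A^-1. By
    Cramer's rule the i-th summand is its i-th diagonal entry times phi(A), and conjugation
    preserves the trace. *)
Lemma alternating_trace A (D : 'M[F]_n) : phi A != 0 ->
  \sum_i phi (set_row A i (row i A *m D)) = \tr D * phi A.
Proof.
move=> /alternating_unitmx uA.
have -> : \tr D = \tr (A *m D *m invmx A) by rewrite mxtrace_mulC mulKmx.
rewrite /mxtrace mulr_suml; apply: eq_bigr => i _.
have -> : row i A *m D = row i (A *m D *m invmx A) *m A.
  by rewrite -row_mul mulmxKV// row_mul.
by rewrite phi_set_rowM mxE.
Qed.

End alternating_forms.

Section unimodularity.
Context {F : fieldType}.

(** [restrictmx] uses the basis [row_base K], while the rows of [D] are another basis of the same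
    space, in which [L] has matrix [Ad]. The change of basis does not affect the trace. *)
Lemma mxtrace_restrictmx m n p (K : 'M[F]_(p, n)) (D : 'M[F]_(m, n)) (L : 'M[F]_n)
    (Ad : 'M[F]_m) : row_free D -> (K :=: D)%MS -> D *m L = Ad *m D ->
  \tr (restrictmx K L) = \tr Ad.
Proof.
move=> fD KD DL; set W := row_base K.
have WK : (W :=: K)%MS by exact: eq_row_base.
have WD : W = W *m pinvmx D *m D by rewrite mulmxKpV// WK KD.
have -> : conjmx W L = W *m pinvmx D *m (Ad *m (D *m pinvmx W)).
  by rewrite /conjmx {1}WD -(mulmxA _ D L) DL !mulmxA.
rewrite mxtrace_mulC -(mulmxA Ad).
suff -> : D *m pinvmx W *m (W *m pinvmx D) = 1%:M by rewrite mulmx1.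
by rewrite (mulmxA _ W) mulmxKpV ?mulmxVp// WK KD.
Qed.

End unimodularity.

(** T D = 0 gives one inclusion, and both spaces have dimension n - k = m. *)
Lemma annihilator_eqmx (F : fieldType) n k m (T : 'M[F]_(k, n)) (D : 'M[F]_(n, m)) :
  row_free T -> row_full D -> T *m D = 0 -> n = (k + m)%N ->
  (kermx T^T :=: D^T)%MS.
Proof.
move=> fT fD TD nkm; apply/eqmx_sym/eqmxP; rewrite -mxrank_leqif_eq; last first.
  by apply/sub_kermxP; rewrite -trmx_mul TD trmx0.
rewrite mxrank_ker !mxrank_tr; move: fT fD; rewrite /row_free /row_full.
by move=> /eqP -> /eqP ->; rewrite nkm addKn.
Qed.

(** The [C l] are the structure constants of a bracket on row vectors of length m, which D^T carries
    isomorphically onto the annihilator. The last hypothesis says that the adjoint maps of the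
    standard basis vectors have trace zero. *)
Lemma unimodular_annihilator (R : realType) n k m
    (br : 'rV[R]_n -> 'rV[R]_n -> 'rV[R]_n) (T : 'M[R]_(k, n)) (D : 'M[R]_(n, m))
    (C : 'I_m -> 'M[R]_m) :
  row_free T -> row_full D -> T *m D = 0 -> n = (k + m)%N ->
  (forall xi, linear (br xi)) ->
  (forall a b : 'rV[R]_m, br (a *m D^T) (b *m D^T) =
     (\row_l (a *m C l *m b^T) 0 0) *m D^T) ->
  (forall i, \sum_j C j i j = 0) ->
  unimodular br (kermx T^T).
Proof.
move=> fT fD TD nkm br_lin brD C0 x.
have KD := annihilator_eqmx fT fD TD nkm.
rewrite KD => /submxP[a ->].
pose brM := GRing.isLinear.Build _ _ _ _ _ (br_lin (a *m D^T)).
pose brL : {linear _ -> _} := HB.pack (br (a *m D^T)) brM.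
(* The matrix of the adjoint map of [a] in the standard basis: row j holds the components of the
   bracket of [a] with the j-th basis vector. *)
pose Ad : 'M[R]_m := \matrix_(j, l) (a *m C l) 0 j.
have fDT : row_free D^T by rewrite /row_free mxrank_tr.
rewrite (mxtrace_restrictmx (Ad := Ad) fDT KD).
  rewrite /mxtrace (eq_bigr (fun j => \sum_i a 0 i * C j i j)).
    by rewrite exchange_big big1// => i _; rewrite -mulr_sumr C0 mulr0.
  by move=> j _; rewrite !mxE.
apply/row_matrixP => j; rewrite !row_mul (mul_rV_lin1 brL) /= (rowE j D^T) brD.
congr (_ *m _); apply/rowP => l; rewrite mxE mxE [RHS]mxE [RHS]mxE.
have dE i : (delta_mx 0 j : 'rV[R]_m)^T i 0 = (i == j)%:R by rewrite !mxE eqxx.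
rewrite (bigD1 j)//= [X in _ + X]big1 => [|i /negbTE ij].
  by rewrite addr0 dE eqxx mulr1.
by rewrite dE ij mulr0.
Qed.

(** * Derivative of the divergence at a critical point *)

Section divergence.
Context {R : realType} {m : nat}.
Variables (U : set 'rV[R]_m) (x0 : 'rV[R]_m) (A : 'rV[R]_m -> 'M[R]_m).
Variables (g f : 'rV[R]_m -> R^o).
Hypotheses (oU : open U) (Ux0 : U x0).
Hypotheses (sA : smooth_on U A) (sg : smooth_on U g) (sf : smooth_on U f).
Hypothesis asymA : forall x, U x -> (A x)^T = - A x.
Hypothesis A0 : A x0 = 0.
Hypothesis dg0 : grad g x0 = 0.

Let a i j : 'rV[R]_m -> R^o := fun x => A x i j.

Let sa i j : smooth_on U (a i j). Proof. exact: smooth_on_entry. Qed.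

Let dS (F : 'rV[R]_m -> R^o) x : smooth_on U F -> U x -> differentiable F x.
Proof. exact: smooth_on_differentiable. Qed.

Let W j : 'rV[R]_m -> R^o := fun x => \sum_i pd g i x * a i j x.

Let dpa i j x : U x -> differentiable (fun y => pd g i y * a i j y : R^o) x.
Proof.
move=> Ux; apply: (@differentiableM R _ (pd g i) (a i j) x).
  exact: dS (smooth_on_pd _ sg) Ux.
exact: dS (sa _ _) Ux.
Qed.

Let dW j x : U x -> differentiable (W j) x.
Proof. by move=> Ux; apply: differentiable_fsum => i; exact: dpa. Qed.

Let pdW j k x : U x ->
  pd (W j) k x = \sum_i (pd (pd g i) k x * a i j x + pd g i x * pd (a i j) k x).
Proof.
move=> Ux; rewrite pd_sum => [|i]; last exact: dpa.
apply: eq_bigr => i _; apply: pdM.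
  exact: dS (smooth_on_pd _ sg) Ux.
exact: dS (sa _ _) Ux.
Qed.

Lemma differentiable_contraction x : U x -> differentiable (fun y => grad g y *m A y) x.
Proof.
move=> Ux.
have sW j : smooth_on U (W j).
  move=> k; apply: (@Ck_sum _ _ _ _ k U (fun i x => pd g i x * a i j x)) => // i.
  by apply: CkM => //; [exact: smooth_on_pd|exact: sa].
apply: (smooth_on_differentiable (U := U)) => // k.
apply: (@Ck_ext _ _ _ _ _ (fun x => \row_j W j x)) => //.
  move=> y _; apply/rowP => j; rewrite !mxE.
  by apply: eq_bigr => i _; rewrite mxE.
by apply: Ck_row => // j; exact: sW.
Qed.

(** The left side is the divergence of the Hamiltonian field, whose components are the [W j]; the
    right side is Leibniz applied to each product. *)
Lemma jac_contraction_trace x : U x ->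
  \tr (jac (fun y => grad g y *m A y) x) =
  \sum_j \sum_i (pd (pd g i) j x * a i j x + pd g i x * pd (a i j) j x).
Proof.
move=> Ux; rewrite /mxtrace; apply: eq_bigr => j _.
rewrite jacE; last exact: differentiable_contraction.
rewrite -(pdW j j Ux); congr (pd _ j x); apply/funext => y.
by rewrite mxE; apply: eq_bigr => i _; rewrite mxE.
Qed.

Let pdg0 i : pd g i x0 = 0.
Proof. by move/rowP: dg0 => /(_ i); rewrite !mxE. Qed.

Let a0 i j : a i j x0 = 0. Proof. by rewrite /a A0 mxE. Qed.

Let Uat : \forall x \near x0, U x.
Proof. exact: open_nbhs_nbhs. Qed.

Let pda_anti i j k : pd (a i j) k x0 = - pd (a j i) k x0.
Proof.
apply/eqP; rewrite -addr_eq0 -pdD; [|exact: dS (sa _ _) Ux0..].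
rewrite -(pd_cst 0 k x0); apply/eqP/near_eq_pd; last first.
  apply: differentiableD; exact: dS (sa _ _) Ux0.
apply: filterS Uat => x Ux; have /matrixP/(_ i j) := asymA Ux.
by rewrite !mxE /a => ->; rewrite subrr.
Qed.

Let hess_sym i j : pd (pd g i) j x0 = pd (pd g j) i x0.
Proof.
apply: pd_comm.
- by apply: filterS Uat => x; exact: dS.
- exact: dS (smooth_on_pd _ sg) Ux0.
- exact: dS (smooth_on_pd _ sg) Ux0.
Qed.

(** Exchanging the indices fixes the Hessian factor and negates the other one, so the sum equals its
    own opposite. *)
Let contraction0 k : \sum_j \sum_i pd (pd g i) j x0 * pd (a i j) k x0 = 0.
Proof.
set s := LHS; have : s = - s.
  rewrite {1}/s exchange_big -sumrN; apply: eq_bigr => i _.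
  rewrite -sumrN; apply: eq_bigr => j _.
  by rewrite hess_sym pda_anti mulrN.
by move/eqP; rewrite -subr_eq0 opprK -mulr2n mulrn_eq0 => /eqP.
Qed.

Lemma linearized_divergence : f x0 != 0 ->
  (\forall x \near x0, 'd f x (grad g x *m A x) +
     \tr (jac (fun y => grad g y *m A y) x) * f x = 0) ->
  forall k, \sum_i pd (pd g i) k x0 * \sum_j pd (fun x => A x i j : R^o) j x0 = 0.
Proof.
move=> f0 div0 k.
(* [T] is the divergence, split into terms [u] with second derivatives of [g] and terms [v] with
   first derivatives; the sum of the [Q l] is the derivative of [f] along the Hamiltonian field. *)
pose u j i : 'rV[R]_m -> R^o := fun x => pd (pd g i) j x * a i j x.
pose v j i : 'rV[R]_m -> R^o := fun x => pd g i x * pd (a i j) j x.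
pose T : 'rV[R]_m -> R^o := fun x => \sum_j \sum_i (u j i x + v j i x).
pose Q l : 'rV[R]_m -> R^o := fun x => W l x * pd f l x.
have spg i := smooth_on_pd i sg.
have du j i : differentiable (u j i) x0.
  apply: (@differentiableM R _ (pd (pd g i) j) (a i j) x0).
    exact: dS (smooth_on_pd _ (spg _)) Ux0.
  exact: dS (sa _ _) Ux0.
have dv j i : differentiable (v j i) x0.
  apply: (@differentiableM R _ (pd g i) (pd (a i j) j) x0).
    exact: dS (spg _) Ux0.
  exact: dS (smooth_on_pd _ (sa _ _)) Ux0.
have duv j i : differentiable (fun x => u j i x + v j i x : R^o) x0.
  exact: differentiableD (du _ _) (dv _ _).
have duvs j : differentiable (fun x => \sum_i (u j i x + v j i x) : R^o) x0.
  exact: differentiable_fsum.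
have dT : differentiable T x0 by exact: differentiable_fsum.
have df : differentiable f x0 by exact: dS.
have dpf l : differentiable (pd f l) x0 by exact: dS (smooth_on_pd _ sf) Ux0.
have dWx l := dW l Ux0.
have dQ l : differentiable (Q l) x0 by exact: (@differentiableM R _ (W l) _ x0).
have T0 : T x0 = 0.
  rewrite /T big1// => j _; rewrite big1// => i _.
  by rewrite /u /v pdg0 a0 mulr0 mul0r addr0.
(* At [x0] only the derivative of the nonvanishing factor's partner survives in each product: the
   [u] terms add up to [contraction0], the [v] terms to the Hessian applied to the divergence of the
   bivector. *)
have pdT : pd T k x0 = \sum_i pd (pd g i) k x0 * \sum_j pd (a i j) j x0.
  rewrite /T pd_sum//.
  under eq_bigr => j _.
    rewrite pd_sum//; under eq_bigr => i _.
      rewrite pdD// (pdM (f := pd (pd g i) j)); last 2 first.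
        exact: dS (smooth_on_pd _ (spg _)) Ux0.
        exact: dS (sa _ _) Ux0.
      rewrite (pdM (f := pd g i)); last 2 first.
        exact: dS (spg _) Ux0.
        exact: dS (smooth_on_pd _ (sa _ _)) Ux0.
      rewrite a0 mulr0 add0r pdg0 mul0r addr0.
      over.
    rewrite big_split.
    over.
  rewrite big_split/= contraction0 add0r exchange_big.
  by apply: eq_bigr => i _; rewrite mulr_sumr.
(* [W l] is a sum of products of two functions vanishing at [x0], so it vanishes there together with
   its first derivatives. *)
have pdQ l : pd (Q l) k x0 = 0.
  rewrite (pdM (f := W l))// pdW// /W big1 => [|i _]; last first.
    by rewrite a0 pdg0 mulr0 mul0r addr0.
  by rewrite mul0r big1 ?mul0r ?addr0// => i _; rewrite pdg0 mul0r.
have dsQ : differentiable (fun x => \sum_l Q l x : R^o) x0.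
  exact: differentiable_fsum.
have dTf : differentiable (fun x => T x * f x : R^o) x0.
  exact: (@differentiableM R _ T f x0).
have : pd (fun x => \sum_l Q l x + T x * f x) k x0 = 0.
  rewrite -[RHS](pd_cst 0 k x0); apply: near_eq_pd; last first.
    exact: (differentiableD dsQ dTf).
  apply: filterS2 Uat div0 => x Ux; rewrite jac_contraction_trace// => E.
  rewrite -[RHS]E; congr (_ + _); rewrite diff_pd; apply: eq_bigr => l _.
  by rewrite /Q mxE; congr (_ * _); apply: eq_bigr => i _; rewrite mxE.
rewrite pdD// pd_sum// big1// add0r (pdM (f := T))// T0 mul0r addr0 pdT => /eqP.
by rewrite mulf_eq0 (negbTE f0) orbF => /eqP.
Qed.

End divergence.

(** * Fields in charts *)

Lemma smooth_map_differentiable {R : realType} {S T : topologicalType} {n m : nat}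
    (M : charted R S n) (N : charted R T m) (f : S -> T) c d p :
  smooth_map M N f -> atlas M c -> atlas N d -> cdom c p -> cdom d (f p) ->
  differentiable (d \o f \o cinv c) (c p).
Proof.
move=> [_ sf] ac ad cp dfp; apply: smooth_on_differentiable (sf c d ac ad) _.
by exists p.
Qed.

HB.lock Definition transition (R : realType) (T : topologicalType) n
  (c d : chart R T n) (p : T) : 'M[R]_n := chart_change c d p.

Lemma chart_changeE (R : realType) (T : topologicalType) n (c d : chart R T n) p :
  chart_change c d p = transition c d p.
Proof. by rewrite transition.unlock. Qed.

Lemma transitionE (R : realType) (T : topologicalType) n (c d : chart R T n) p :
  transition c d p = jac (d \o cinv c) (c p).
Proof. by rewrite transition.unlock jac.unlock. Qed.

Section manifold_charts.
Context {R : realType} {T : topologicalType} {n : nat}.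
Variable M : charted R T n.
Hypothesis hM : manifold M.
Implicit Types (c d e : chart R T n) (p : T).

Let ch c : atlas M c -> is_chart c. Proof. by case: hM => _ _ + _ _; exact. Qed.

Lemma atlas_chart_at p : atlas M (chart_at M p).
Proof. by case: hM => _ _ _ /(_ p)[]. Qed.

Lemma cdom_chart_at p : cdom (chart_at M p) p.
Proof. by case: hM => _ _ _ /(_ p)[]. Qed.

Lemma cinvK c p : atlas M c -> cdom c p -> cinv c (c p) = p.
Proof. by move=> /ch[_ _ cK _ _]; exact: cK. Qed.

Lemma open_ccodom c : atlas M c -> open (ccodom c).
Proof. by move=> /ch[]. Qed.

Lemma differentiable_transition c d p : atlas M c -> atlas M d ->
  cdom c p -> cdom d p -> differentiable (d \o cinv c) (c p).
Proof.
move=> ac ad cp dp; have [_ _ _ _ sM] := hM.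
by apply: smooth_on_differentiable (sM c d ac ad) _; exists p.
Qed.

Lemma transition_id c p : atlas M c -> cdom c p -> transition c c p = 1%:M.
Proof.
move=> ac cp; rewrite transitionE -(jac_id (c p)).
apply: near_eq_jac; last exact: differentiable_transition.
have np : nbhs p [set: T] by exact: filterT.
by apply: filterS (chart_near (ch ac) cp np) => x [].
Qed.

Lemma transition_comp c d e p : atlas M c -> atlas M d -> atlas M e ->
  cdom c p -> cdom d p -> cdom e p ->
  transition c d p *m transition d e p = transition c e p.
Proof.
move=> ac ad ae cp dp ep; rewrite !transitionE; apply/esym.
apply: (@jac_rep_comp R T T T n n n c d e id id p) => //;
  [exact: ch|exact: ch|exact: differentiable_transition..].
Qed.

Lemma dfun_chart (f : T -> R) c p : smooth_fun M f -> atlas M c -> cdom c p ->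
  dfun M f p =
  grad (f \o cinv c) (c p) *m (transition (chart_at M p) c p)^T.
Proof.
move=> sf ac cp; set c0 := chart_at M p.
have ac0 : atlas M c0 by exact: atlas_chart_at.
have c0p : cdom c0 p by exact: cdom_chart_at.
have dfE : dfun M f p = grad (f \o cinv c0) (c0 p).
  by apply/rowP => i; rewrite !mxE pd.unlock.
have dc := differentiable_transition ac0 ac c0p cp.
have cK : (c \o cinv c0) (c0 p) = c p by rewrite /= cinvK.
have df x : ccodom c x -> differentiable (f \o cinv c : 'rV[R]_n -> R^o) x.
  exact: smooth_on_differentiable (sf c ac).
have df0 : differentiable (f \o cinv c0 : 'rV[R]_n -> R^o) (c0 p).
  by apply: smooth_on_differentiable (sf c0 ac0) _; exists p.
have dfc : differentiable (f \o cinv c : 'rV[R]_n -> R^o) ((c \o cinv c0) (c0 p)).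
  by rewrite cK; apply: df; exists p.
rewrite dfE transitionE -cK -(grad_comp dc dfc).
apply/rowP => i; rewrite !mxE; apply: near_eq_pd => //.
have oc : nbhs p (cdom c) by apply: open_nbhs_nbhs; split => //; case: (ch ac).
apply: filterS (chart_near (ch ac0) c0p oc) => x [_ _ cx _].
by rewrite /= cinvK.
Qed.

(** The transposed transition coming from [dfun_chart] and the transition in [vf_in] are exactly the
    outer factors of [bivector_in]. *)
Lemma hamiltonian_vf_in (P : T -> 'M[R]_n) (h : T -> R) c x :
  smooth_fun M h -> atlas M c -> ccodom c x ->
  vf_in M c (hamiltonian_vf M P h) x = grad (h \o cinv c) x *m bivector_in M c P x.
Proof.
move=> sh ac [p cp <-].
rewrite /vf_in /bivector_in /hamiltonian_vf !chart_changeE !cinvK//.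
by rewrite (dfun_chart sh ac cp) !mulmxA.
Qed.

Section constant_vf.
Variables (c : chart R T n) (Y : 'rV[R]_n).
Hypothesis ac : atlas M c.

(** Has constant components [Y] in the chart [c], and is meaningful on [cdom c] only. It serves as
    the extension of a tangent vector in the definition of the Hessian. *)
Definition constant_vf (p : T) : 'rV[R]_n := Y *m transition c (chart_at M p) p.

Lemma constant_vf_in d p : atlas M d -> cdom c p -> cdom d p ->
  vf_in M d constant_vf (d p) = Y *m transition c d p.
Proof.
move=> ad cp dp; rewrite /vf_in /constant_vf !chart_changeE cinvK//.
rewrite -mulmxA transition_comp//.
- exact: atlas_chart_at.
- exact: cdom_chart_at.
Qed.

Lemma smooth_constant_vf : smooth_vf_on M (cdom c) constant_vf.
Proof.
move=> d ad; have [oc _ _ _ _] := ch ac; have [od _ _ _ _] := ch ad.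
have [_ _ _ _ sM] := hM.
have oU := open_chart_image (ch ad) oc.
have oU' := open_chart_image (ch ac) od.
(* In the chart [d] the components are the derivative of the transition map along [Y], evaluated at
   the [c]-coordinates of the point. *)
apply: (smooth_on_ext (F := (fun y => 'd (d \o cinv c) y Y) \o (c \o cinv d))) => //.
  move=> _ [p [dp cp] <-]; rewrite constant_vf_in// transitionE mul_jac /=.
  by rewrite cinvK.
apply: (smooth_on_comp (U' := c @` (cdom c `&` cdom d))) => //.
- by move=> _ [p [dp cp] <-] /=; rewrite cinvK//; exists p.
- exact: sM.
- by apply: smooth_on_diff; exact: sM.
Qed.

Lemma constant_vf_apply (h : T -> R) p : smooth_fun M h -> cdom c p ->
  vf_apply M constant_vf h p = (grad (h \o cinv c) (c p) *m Y^T) 0 0.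
Proof.
move=> sh cp; rewrite /vf_apply /pairing (dfun_chart sh ac cp) /constant_vf.
rewrite -mulmxA -trmx_mul -mulmxA transition_comp//; last 2 first.
- exact: atlas_chart_at.
- exact: cdom_chart_at.
by rewrite transition_id// mulmx1.
Qed.

End constant_vf.

(** Testing the definition on the i-th basis vector and on the constant field of the j-th one, which
    sends [h] to its j-th partial derivative near [p], determines every entry of [B]. *)
Lemma hessian_atE (h : T -> R) (p : T) (B : 'M[R]_n) i j : smooth_fun M h ->
  hessian_at M h p B ->
  B i j = pd (pd (h \o cinv (chart_at M p)) j) i (chart_at M p p).
Proof.
move=> sh hB; set c := chart_at M p.
have ac : atlas M c by exact: atlas_chart_at.
have cp : cdom c p by exact: cdom_chart_at.
have [oc _ _ _ _] := ch ac.
pose Y : 'rV[R]_n := delta_mx 0 j.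
have := hB (cdom c) (constant_vf c Y) oc cp (smooth_constant_vf Y ac) (delta_mx 0 i).
have -> : constant_vf c Y p = Y by rewrite /constant_vf transition_id// mulmx1.
have -> : bilin B (delta_mx 0 i) Y = B i j.
  by rewrite /bilin -rowE trmx_delta -colE !mxE.
move=> <-; rewrite /pairing trmx_delta -colE mxE mxE.
have dj : differentiable (pd (h \o cinv c) j) (c p).
  by apply: smooth_on_differentiable (smooth_on_pd j (sh c ac)) _; exists p.
rewrite [RHS](near_eq_pd (g := vf_apply M (constant_vf c Y) h \o cinv c))//.
  by rewrite pd.unlock.
have np : nbhs p [set: T] by exact: filterT.
apply: filterS (chart_near (ch ac) cp np) => x [_ cx _ xE] /=.
rewrite constant_vf_apply// xE /Y trmx_delta -colE !mxE.
by [].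
Qed.

End manifold_charts.

(** * Volume forms preserved by a Hamiltonian vector field *)

Section modular.
Context {R : realType} {T : topologicalType} {m : nat}.
Variable M : charted R T m.
Hypothesis hM : manifold M.

Lemma bivector_in_antisym (P : T -> 'M[R]_m) c x : (forall p, (P p)^T = - P p) ->
  (bivector_in M c P x)^T = - bivector_in M c P x.
Proof.
by move=> aP; rewrite /bivector_in !trmx_mul trmxK aP !mulNmx !mulmxN mulmxA.
Qed.

Lemma bivector_in_id (P : T -> 'M[R]_m) p :
  bivector_in M (chart_at M p) P (chart_at M p p) = P p.
Proof.
have ac := atlas_chart_at hM p; have cp := cdom_chart_at hM p.
rewrite /bivector_in (cinvK hM ac cp) chart_changeE (transition_id hM ac cp).
by rewrite trmx1 mul1mx mulmx1.
Qed.

(** Evaluates the Lie derivative of the form on the constant frame [A0]; since the form is nonzero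
    on it, [alternating_trace] turns the sum over rows into the divergence times the density. *)
Lemma divergence_free_in (P : T -> 'M[R]_m) (h : T -> R)
    (nu : T -> 'M[R]_m -> R) c x (A0 : 'M[R]_m) :
  poisson_structure M P -> smooth_fun M h -> volume_form M nu ->
  preserves_form M (hamiltonian_vf M P h) nu -> atlas M c -> ccodom c x ->
  form_in M c nu x A0 != 0 ->
  let V y := grad (h \o cinv c) y *m bivector_in M c P y in
  'd (form_in M c nu ^~ A0 : 'rV[R]_m -> R^o) x (V x) +
  \tr (jac V x) * form_in M c nu x A0 = 0.
Proof.
move=> [aP sP _] sh [nu_lin nu_alt _ _] pnu ac Cx f0 V.
have oC := open_ccodom hM ac.
have VE y : ccodom c y -> vf_in M c (hamiltonian_vf M P h) y = V y.
  exact: hamiltonian_vf_in.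
have dV : differentiable V x.
  exact: (differentiable_contraction oC (sP c ac) (sh c ac) Cx).
have jE : jacobian (vf_in M c (hamiltonian_vf M P h)) x = jac V x.
  transitivity (jac (vf_in M c (hamiltonian_vf M P h)) x); first by rewrite jac.unlock.
  apply/esym/near_eq_jac => //; apply: filterS (open_nbhs_nbhs (conj oC Cx)) => y Cy.
  by rewrite VE.
rewrite -[RHS](pnu c ac x Cx A0) /lie_form_in jE VE//; congr (_ + _).
apply/esym/(@alternating_trace _ _ (form_in M c nu x)) => //.
- move=> A B C i b d rA rB rC; apply: (nu_lin _ _ _ _ i).
  + by rewrite !row_mul rA mulmxDl !scalemxAl.
  + by rewrite !row'Esub -!mul_rowsub_mx -!row'Esub rB.
  + by rewrite !row'Esub -!mul_rowsub_mx -!row'Esub rC.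
- by move=> A i j ij rA; apply: (nu_alt _ _ _ _ ij); rewrite !row_mul rA.
Qed.

Lemma linearized_poisson_unimodular (P : T -> 'M[R]_m) (h : T -> R) (o : T) :
  poisson_structure M P -> P o = 0 -> smooth_fun M h -> morse_at M h o ->
  (exists2 nu, volume_form M nu & preserves_form M (hamiltonian_vf M P h) nu) ->
  forall i, \sum_j pd (fun x => bivector_in M (chart_at M o) P x i j : R^o) j
    (chart_at M o o) = 0.
Proof.
move=> hP Po sh [dh [B hB Bnd]] [nu nuV pnu]; set c := chart_at M o; set x0 := c o.
have ac : atlas M c := atlas_chart_at hM o.
have co : cdom c o := cdom_chart_at hM o.
have Cx0 : ccodom c x0 by exists o.
have oC := open_ccodom hM ac.
have [aP sP _] := hP; have [_ _ nuS nu0] := nuV; have [A0 nuA0] := nu0 o.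
set g : 'rV[R]_m -> R^o := h \o cinv c.
have sg : smooth_on (ccodom c) g by exact: sh.
have sA : smooth_on (ccodom c) (bivector_in M c P) by exact: sP.
(* The density: the form on a constant frame chosen so that it does not vanish at [o]. *)
pose f : 'rV[R]_m -> R^o := form_in M c nu ^~ A0.
have sf : smooth_on (ccodom c) f by exact: nuS.
have f0 : f x0 != 0.
  by rewrite /f /form_in (cinvK hM ac co) chart_changeE (transition_id hM ac co) mulmx1.
have dg0 : grad g x0 = 0.
  by rewrite -dh (dfun_chart hM sh ac co) (transition_id hM ac co) trmx1 mulmx1.
have A00 : bivector_in M c P x0 = 0 by rewrite bivector_in_id.
have div0 : \forall x \near x0, 'd f x (grad g x *m bivector_in M c P x) +
    \tr (jac (fun y => grad g y *m bivector_in M c P y) x) * f x = 0.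
  have cf : {for x0, continuous f}.
    by apply/differentiable_continuous/(smooth_on_differentiable sf).
  have fx0 : \forall x \near x0, f x != 0 by exact: (cvgr_neq0 _ cf f0).
  apply: filterS2 (open_nbhs_nbhs (conj oC Cx0)) fx0 => x Cx fx.
  exact: divergence_free_in.
have asymA x : ccodom c x -> (bivector_in M c P x)^T = - bivector_in M c P x.
  by move=> _; exact: bivector_in_antisym.
have key := linearized_divergence oC Cx0 sA sg sf asymA A00 dg0 f0 div0.
pose w : 'rV[R]_m := \row_i \sum_j pd (fun x => bivector_in M c P x i j : R^o) j x0.
suff w0 : w = 0 by move=> i; move/rowP: w0 => /(_ i); rewrite !mxE.
have dpg i : differentiable (pd g i) x0.
  by apply: smooth_on_differentiable (smooth_on_pd i sg) _.
have Bsym i j : B i j = B j i.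
  rewrite !(hessian_atE hM _ _ sh hB); apply: pd_comm => //.
  apply: filterS (open_nbhs_nbhs (conj oC Cx0)) => x.
  exact: smooth_on_differentiable.
(* As [B] is the symmetric Hessian matrix, [key] says that w B = 0, so [w] lies in the radical. *)
apply: Bnd => Y; rewrite /bilin (_ : w *m B = 0) ?mul0mx ?mxE//.
apply/rowP => k; rewrite !mxE -[RHS](key k); apply: eq_bigr => i _.
by rewrite mxE Bsym (hessian_atE hM _ _ sh hB) mulrC.
Qed.

End modular.

(** * Poisson maps and their linearization *)

Section affine.
Context {R : realType} {n p : nat}.

(** Continuity is the case k = 0 of [Ck] on the whole space, so the closure properties of [Ck] apply
    entry by entry. *)
Lemma continuous_mulmxr (B : 'M[R]_(n, p)) :
  continuous (mulmxr B : 'rV[R]_n -> 'rV[R]_p).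
Proof.
have oT := @openT 'rV[R]_n.
suff : Ck 0 setT (fun y : 'rV[R]_n => \row_j (\sum_i (y 0 i * B i j) : R^o)).
  move=> cB x; have := cB x I; congr (continuous_at x _); apply/funext => y.
  by apply/rowP => j; rewrite !mxE.
apply: (Ck_row (f := fun j (y : 'rV[R]_n) => \sum_i (y 0 i * B i j))) => // j.
apply: (Ck_sum (f := fun i (y : 'rV[R]_n) => y 0 i * B i j : R^o)) => // i.
apply: (CkM (f := fun y : 'rV[R]_n => y 0 i) (g := fun=> B i j)) => //.
  by move=> y _; exact: coord_continuous.
by move=> y _; exact: cst_continuous.
Qed.

Lemma differentiable_affine (B : 'M[R]_(n, p)) a x :
  differentiable (fun y : 'rV[R]_n => y *m B + a) x.
Proof.
apply: (differentiableD (f := mulmxr B) (g := cst a)); last exact: differentiable_cst.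
exact/linear_differentiable/continuous_mulmxr.
Qed.

Lemma jac_affine (B : 'M[R]_(n, p)) a x : jac (fun y : 'rV[R]_n => y *m B + a) x = B.
Proof.
apply: eq_mulmx_row => v; rewrite mul_jac.
have dB : differentiable (mulmxr B : 'rV[R]_n -> 'rV[R]_p) x.
  exact/linear_differentiable/continuous_mulmxr.
have /(congr1 (@^~ v)) E := diffD dB (differentiable_cst a x).
have /(congr1 (@^~ v)) Ea := diff_cst a x.
have /(congr1 (@^~ v)) EB := diff_lin x (@continuous_mulmxr B).
exact: etrans E (etrans (congr2 +%R EB Ea) (addr0 _)).
Qed.

End affine.

Section poisson_map_charts.
Context {R : realType} {S T : topologicalType} {n m : nat}.
Variables (M : charted R S n) (N : charted R T m).
Hypotheses (hM : manifold M) (hN : manifold N).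

(** [poisson_map] is stated in the preferred charts. The representative of [f] from [c0] to [d]
    factors both through [c] and through [d0], and equating the two factorizations moves the
    identity to arbitrary charts. *)
Lemma poisson_map_in (P : S -> 'M[R]_n) (Q : T -> 'M[R]_m) f c d p :
  poisson_map M N P Q f -> atlas M c -> atlas N d -> cdom c p -> cdom d (f p) ->
  let D := jac (d \o f \o cinv c) (c p) in
  D^T *m bivector_in M c P (c p) *m D = bivector_in N d Q (d (f p)).
Proof.
move=> [sf PQ] ac ad cp dp D; have [cf _] := sf.
have [_ _ chM _ _] := hM; have [_ _ chN _ _] := hN.
set c0 := chart_at M p; set d0 := chart_at N (f p).
have ac0 : atlas M c0 := atlas_chart_at hM p.
have c0p : cdom c0 p := cdom_chart_at hM p.
have ad0 : atlas N d0 := atlas_chart_at hN (f p).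
have d0p : cdom d0 (f p) := cdom_chart_at hN (f p).
have tmE : tangent_map M N f p = jac (d0 \o f \o cinv c0) (c0 p).
  by rewrite jac.unlock.
have E1 : jac (d \o f \o cinv c0) (c0 p) = transition c0 c p *m D.
  rewrite transitionE.
  apply: (@jac_rep_comp R S S T n n m c0 c d id f p) => //;
    [exact: chM|exact: chM| |]. exact: (differentiable_transition hM).
  exact: smooth_map_differentiable sf _ _ _ _.
have E2 : jac (d \o f \o cinv c0) (c0 p) = tangent_map M N f p *m transition d0 d (f p).
  rewrite tmE transitionE.
  apply: (@jac_rep_comp R S T T n m m c0 d0 d f id p) => //;
    [exact: chM|exact: chN|exact: cf| |].
    exact: smooth_map_differentiable sf _ _ _ _.
  exact: (differentiable_transition hN).
rewrite /bivector_in (cinvK hM ac cp) (cinvK hN ad dp) !chart_changeE.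
rewrite -/c0 -/d0 -PQ.
have /(congr1 trmx) := E2; rewrite E1 => ET.
rewrite !trmx_mul in ET.
by rewrite !mulmxA ET -!mulmxA -E1 E2 !mulmxA.
Qed.

End poisson_map_charts.

Definition pd_mx (R : realType) n k l (B : 'rV[R]_n -> 'M[R]_(k, l))
    (x : 'rV[R]_n) (r : 'I_n) : 'M[R]_(k, l) :=
  \matrix_(i, j) pd (fun y => B y i j : R^o) r x.

Section linearization.
Context {R : realType} {n m : nat}.

(** As [B] vanishes at [x], the Leibniz terms that differentiate [J] drop out. *)
Lemma pd_congruence0 (J : 'rV[R]_n -> 'M[R]_(n, m)) (B : 'rV[R]_n -> 'M[R]_n) x r :
  (forall k i, differentiable (fun y => J y k i : R^o) x) ->
  (forall k l, differentiable (fun y => B y k l : R^o) x) -> B x = 0 ->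
  pd_mx (fun y => (J y)^T *m B y *m J y) x r =
  (J x)^T *m pd_mx B x r *m J x.
Proof.
move=> dJ dB B0; apply/matrixP => i j; rewrite mxE.
pose t k l : 'rV[R]_n -> R^o := fun y => (J y k i * J y l j) * B y k l.
have dJJ k l : differentiable (fun y => J y k i * J y l j : R^o) x.
  exact: (@differentiableM R _ (fun y => J y k i) (fun y => J y l j) x).
have dt k l : differentiable (t k l) x.
  exact: (@differentiableM R _ (fun y => J y k i * J y l j) (fun y => B y k l) x).
rewrite (_ : (fun y => _) = fun y => \sum_l \sum_k t k l y); last first.
  apply/funext => y; rewrite mxE; apply: eq_bigr => l _.
  rewrite mxE mulr_suml; apply: eq_bigr => k _.
  by rewrite mxE /t mulrAC.
rewrite pd_sum => [|l]; last exact: differentiable_fsum.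
rewrite [RHS]mxE; apply: eq_bigr => l _; rewrite pd_sum//.
rewrite mxE mulr_suml; apply: eq_bigr => k _.
rewrite (pdM (f := fun y => J y k i * J y l j))// B0 mxE mulr0 add0r.
by rewrite !mxE mulrAC.
Qed.

Lemma pd_mx_comp (F : 'rV[R]_n -> 'rV[R]_m) k l (A : 'rV[R]_m -> 'M[R]_(k, l)) x r :
  differentiable F x -> differentiable A (F x) ->
  pd_mx (A \o F) x r =
  \sum_s jac F x r s *: pd_mx A (F x) s.
Proof.
move=> dF dA; apply/matrixP => i j; rewrite mxE summxE.
have /rowP/(_ r) := grad_comp dF (differentiable_entry i j dA); rewrite mxE => E.
apply: etrans E _; rewrite mxE; apply: eq_bigr => s _.
by rewrite !mxE mulrC.
Qed.

End linearization.

(** * Poisson-Lie groups *)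

(** Differentiates the identity of [poisson_map_in] at a zero of [P]: the left side by
    [pd_congruence0], the right side by the chain rule. Dually, the transpose of [D] respects the
    linearized brackets on covectors. *)
Lemma linearized_poisson_map {R : realType} {S T : topologicalType} {n m : nat}
    (M : charted R S n) (N : charted R T m) (P : S -> 'M[R]_n) (Q : T -> 'M[R]_m)
    f c d p r :
  manifold M -> manifold N -> smooth_bivector M P -> smooth_bivector N Q ->
  poisson_map M N P Q f -> atlas M c -> atlas N d -> cdom c p -> cdom d (f p) ->
  bivector_in M c P (c p) = 0 ->
  let D := jac (d \o f \o cinv c) (c p) in
  D^T *m pd_mx (bivector_in M c P) (c p) r *m D =
  \sum_s D r s *: pd_mx (bivector_in N d Q) (d (f p)) s.
Proof.
move=> hM hN sP sQ hf ac ad cp dp B0 D; have [sf _] := hf; have [cf sF] := sf.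
have [_ _ chM _ _] := hM; have [_ _ chN _ _] := hN.
set F := d \o f \o cinv c; set U := c @` (cdom c `&` f @^-1` cdom d).
have {}sF : smooth_on U F by exact: sF.
have oU : open U.
  apply: open_chart_image; first exact: chM.
  by apply: open_comp; [move=> x _; exact: cf|case: (chN _ ad)].
have Ux : U (c p) by exists p.
have nU : \forall x \near c p, U x by exact: open_nbhs_nbhs.
have Fp : F (c p) = d (f p) by rewrite /F /= (cinvK hM ac cp).
have dF : differentiable F (c p) by exact: smooth_on_differentiable sF Ux.
have dB : differentiable (bivector_in M c P) (c p).
  by apply: smooth_on_differentiable (sP c ac) _; exists p.
have dA : differentiable (bivector_in N d Q) (F (c p)).
  by apply: smooth_on_differentiable (sQ d ad) _; exists (f p).
rewrite -pd_congruence0//; last 2 first.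
(* Near [c p] the entries of the Jacobian are partial derivatives of the smooth map [F]. *)
- move=> k i.
  apply: (near_eq_differentiable (f := pd (fun y => F y 0 i) k)).
    apply: filterS nU => x Ux'; rewrite jacE//.
    exact: smooth_on_differentiable sF Ux'.
  apply: smooth_on_differentiable Ux.
  exact/smooth_on_pd/smooth_on_entry.
- by move=> k l; exact: differentiable_entry.
rewrite -Fp -(pd_mx_comp _ dF dA); apply/matrixP => i j; rewrite !mxE.
apply/esym/near_eq_pd; last first.
  apply: (differentiable_comp (f := F)
    (g := fun y => bivector_in N d Q y i j : R^o)) => //.
  exact: differentiable_entry.
apply: filterS nU => _ [y [cy dy] <-].
rewrite (poisson_map_in hM hN hf ac ad cy dy).
by rewrite /F /= (cinvK hM ac cy).
Qed.

Section poisson_lie.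
Context {R : realType} {G : groupTopType} {n : nat}.
Variable MG : charted R G n.

(** The differential of the multiplication at the identity is addition, since its restrictions to
    the two slices x 1 and 1 x are the identity. *)
Lemma jac_mul1 : lie_group MG ->
  jac (chart_at MG (1 * 1)%g \o (fun x : G * G => (x.1 * x.2)%g) \o
       cinv (chart_at (charted_prod MG MG) (1%g, 1%g)))
    (chart_at (charted_prod MG MG) (1%g, 1%g) (1%g, 1%g)) = col_mx 1%:M 1%:M.
Proof.
move=> [hM smul _]; set cc := chart_at (charted_prod MG MG) (1%g, 1%g).
set c := chart_at MG 1%g.
have ac : atlas MG c := atlas_chart_at hM 1%g.
have c1 : cdom c 1%g := cdom_chart_at hM 1%g.
have [_ _ chM _ _] := hM.
rewrite mulg1 -/c; set phi := (c \o _ \o _).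
have dphi : differentiable phi (cc (1%g, 1%g)).
  apply: (smooth_map_differentiable smul) => //.
  - by exists c => //; exists c.
  - by rewrite /= mulg1.
have np : nbhs (1%g : G) [set: G] by exact: filterT.
have id_near (u : 'rV[R]_n -> 'rV[R]_n) : {near c 1%g, u =1 id} ->
    differentiable u (c 1%g) -> jac u (c 1%g) = 1%:M.
  by move=> uid du; rewrite (near_eq_jac uid du) jac_id.
(* The coordinate forms of the slices, as affine maps so that their Jacobians are explicit. *)
pose l1 (y : 'rV[R]_n) := y *m row_mx 1%:M 0 + row_mx 0 (c 1%g).
pose l2 (y : 'rV[R]_n) := y *m row_mx 0 1%:M + row_mx (c 1%g) 0.
have l1E y : l1 y = row_mx y (c 1%g).
  by rewrite /l1 mul_mx_row mulmx1 mulmx0 add_row_mx addr0 add0r.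
have l2E y : l2 y = row_mx (c 1%g) y.
  by rewrite /l2 mul_mx_row mulmx1 mulmx0 add_row_mx addr0 add0r.
have ccE : cc (1%g, 1%g) = row_mx (c 1%g) (c 1%g) by [].
have d1 : differentiable l1 (c 1%g) by exact: differentiable_affine.
have d2 : differentiable l2 (c 1%g) by exact: differentiable_affine.
have dphi1 : differentiable phi (l1 (c 1%g)) by rewrite l1E -ccE.
have dphi2 : differentiable phi (l2 (c 1%g)) by rewrite l2E -ccE.
have u1 : usubmx (jac phi (cc (1%g, 1%g))) = 1%:M.
  rewrite -(id_near (phi \o l1)); last exact: differentiable_comp.
    rewrite jac_comp// jac_affine l1E -ccE -[in RHS](vsubmxK (jac phi _)).
    by rewrite mul_row_col mul1mx mul0mx addr0.
  apply: filterS (chart_near (chM _ ac) c1 np) => x [_ _ _ xE].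
  rewrite /= l1E /phi /= row_mxKl row_mxKr.
  by rewrite (cinvK hM ac c1) mulg1.
have u2 : dsubmx (jac phi (cc (1%g, 1%g))) = 1%:M.
  rewrite -(id_near (phi \o l2)); last exact: differentiable_comp.
    rewrite jac_comp// jac_affine l2E -ccE -[in RHS](vsubmxK (jac phi _)).
    by rewrite mul_row_col mul1mx mul0mx add0r.
  apply: filterS (chart_near (chM _ ac) c1 np) => x [_ _ _ xE].
  rewrite /= l2E /phi /= row_mxKl row_mxKr.
  by rewrite (cinvK hM ac c1) mul1g.
by rewrite -[LHS]vsubmxK u1 u2.
Qed.

(** Multiplicativity at the pair of identities reads P(1) + P(1) = P(1). *)
Lemma poisson_lie_group1 (P : G -> 'M[R]_n) : poisson_lie_group MG P -> P 1%g = 0.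
Proof.
move=> [lG _ [_ /(_ (1%g, 1%g))]].
have -> : tangent_map (charted_prod MG MG) MG (fun x : G * G => (x.1 * x.2)%g)
    (1%g, 1%g) = col_mx 1%:M 1%:M.
  by rewrite -(jac_mul1 lG) jac.unlock.
rewrite /bivector_prod /= tr_col_mx !trmx1 mul_row_block !mul1mx.
rewrite addr0 add0r mul_row_col !mulmx1 mulg1.
by move=> /eqP; rewrite -subr_eq0 addrK => /eqP.
Qed.

Lemma left_invariant_vf1 (X : 'rV[R]_n) : manifold MG ->
  left_invariant_vf MG X 1%g = X.
Proof.
move=> hM; rewrite /left_invariant_vf.
have -> : (fun x : G => (1 * x)%g) = id by apply/funext => x; rewrite mul1g.
rewrite [tangent_map _ _ _ _](_ : _ = 1%:M) ?mulmx1//.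
rewrite -(transition_id hM (atlas_chart_at hM 1%g) (cdom_chart_at hM 1%g)).
by rewrite transition.unlock.
Qed.

(** The two Schouten terms that differentiate the left-invariant field carry the factor P(1) = 0;
    only the derivative of the components of [P] remains. *)
Lemma cobracketE (P : G -> 'M[R]_n) r : manifold MG -> smooth_bivector MG P ->
  P 1%g = 0 ->
  cobracket MG P (delta_mx 0 r) =
  pd_mx (bivector_in MG (chart_at MG 1%g) P) (chart_at MG 1%g 1%g) r.
Proof.
move=> hM sP P1; set c := chart_at MG 1%g.
have ac : atlas MG c := atlas_chart_at hM 1%g.
have c1 : cdom c 1%g := cdom_chart_at hM 1%g.
have B0 : bivector_in MG c P (c 1%g) = 0 by rewrite bivector_in_id.
rewrite /cobracket /schouten_vf_bivector -/c B0 mulmx0 mul0mx !subr0.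
rewrite {1}/vf_in (cinvK hM ac c1) left_invariant_vf1// chart_changeE.
rewrite (transition_id hM ac c1) mulmx1.
apply/matrixP => i j; rewrite mxE pd.unlock diff_entry//.
by apply: smooth_on_differentiable (sP c ac) _; exists 1%g.
Qed.

Lemma linear_dual_bracket (P : G -> 'M[R]_n) (xi : 'rV[R]_n) :
  linear (dual_bracket MG P xi).
Proof.
move=> a u v; apply/rowP => r; rewrite !mxE /bilin.
by rewrite linearP /= mulmxDr -scalemxAr !mxE.
Qed.

End poisson_lie.

(** * The projection onto the coset space *)

Lemma coset_proj_range {G H : groupTopType} (i : UMagmaMorphism.type H G) (x : H) :
  coset_proj i (i x) = coset_proj i 1%g.
Proof.
apply/eqmodP; apply/asboolP; exists (x^-1)%g => //.
by rewrite gmulfV mulg1.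
Qed.

(** The composite of the inclusion with the projection is constant. Charts are taken at [i 1],
    rewritten from [1], so that the chain rule applies. *)
Lemma tangent_map_coset_proj {R : realType} {G H : groupTopType} {n k m : nat}
    (MG : charted R G n) (MH : charted R H k) (i : UMagmaMorphism.type H G)
    (M : charted R (coset_space i) m) :
  manifold MG -> manifold MH -> manifold M -> smooth_map MH MG i ->
  smooth_map MG M (coset_proj i) ->
  tangent_map MH MG i 1%g *m tangent_map MG M (coset_proj i) 1%g = 0.
Proof.
move=> hG hH hM si sq; set q := coset_proj i.
have i1 : i 1%g = 1%g by exact: gmulf1.
set b := chart_at MH 1%g; set c := chart_at MG 1%g; set d := chart_at M (q 1%g).
have [_ _ chH _ _] := hH; have [_ _ chG _ _] := hG.
have ab : atlas MH b := atlas_chart_at hH _.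
have b1 : cdom b 1%g := cdom_chart_at hH _.
have ac : atlas MG c := atlas_chart_at hG _.
have c1 : cdom c (i 1%g) by rewrite i1; exact: (cdom_chart_at hG).
have ad : atlas M d := atlas_chart_at hM _.
have d1 : cdom d (q (i 1%g)) by rewrite i1; exact: (cdom_chart_at hM).
have -> : tangent_map MH MG i 1%g = jac (c \o i \o cinv b) (b 1%g).
  by rewrite /tangent_map i1 jac.unlock.
have -> : tangent_map MG M q 1%g = jac (d \o q \o cinv c) (c (i 1%g)).
  by rewrite i1 jac.unlock.
have ci := si.1 1%g.
have di := smooth_map_differentiable si ab ac b1 c1.
have dq := smooth_map_differentiable sq ac ad c1 d1.
rewrite -(jac_rep_comp (chH _ ab) (chG _ ac) b1 c1 ci di dq).
rewrite -[RHS](jac_cst (d (q 1%g)) (b 1%g)); congr (jac _ _); apply/funext => x /=.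
by rewrite /q coset_proj_range.
Qed.

Theorem theorem6p4 (R : realType) (n k m : nat)
  (G : groupTopType) (MG : charted R G n) (PG : G -> 'M[R]_n)
  (hG : poisson_lie_group MG PG) (hGconn : connected [set: G])
  (H : groupTopType) (MH : charted R H k) (i : UMagmaMorphism.type H G)
  (hH : closed_connected_lie_subgroup MG MH i)
  (M : charted R (coset_space i) m) (hM : homogeneous_manifold MG MH M)
  (P : coset_space i -> 'M[R]_m) (hP : coisotropic_poisson MG M PG P)
  (h : coset_space i -> R) (hsmooth : smooth_fun M h)
  (hmorse : morse_at M h (coset_proj i 1%g))
  (hvol : exists2 nu : coset_space i -> 'M[R]_m -> R,
     volume_form M nu & preserves_form M (hamiltonian_vf M P h) nu) :
  unimodular (dual_bracket MG PG) (lie_annihilator MG MH i).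
Proof.
have [[mG _ _] [_ sPG _] _] := hG; have PG1 := poisson_lie_group1 hG.
have [[mH _ _] _ [si ri] _ _] := hH; have [mM [sq rq] dimE] := hM.
have [pP _ qP] := hP; have [_ sP _] := pP.
set q := coset_proj i; set c := chart_at MG 1%g; set d := chart_at M (q 1%g).
have P1 : P (q 1%g) = 0 by have [_ <-] := qP; rewrite PG1 mulmx0 mul0mx.
have ac : atlas MG c := atlas_chart_at mG _.
have c1 : cdom c 1%g := cdom_chart_at mG _.
have ad : atlas M d := atlas_chart_at mM _.
have d1 : cdom d (q 1%g) := cdom_chart_at mM _.
pose D := jac (d \o q \o cinv c) (c 1%g).
have DE : tangent_map MG M q 1%g = D by rewrite /D jac.unlock.
(* Structure constants of the linearized bracket on the cotangent space at eH. *)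
pose C s := pd_mx (bivector_in M d P) (d (q 1%g)) s.
have B0 : bivector_in MG c PG (c 1%g) = 0 by rewrite bivector_in_id.
apply: (unimodular_annihilator (D := D) (C := C)).
- exact: ri.
- by rewrite -DE; exact: rq.
- by rewrite -DE; exact: tangent_map_coset_proj.
- exact: dimE.
- by move=> xi; exact: linear_dual_bracket.
(* The dual bracket is the linearization of [PG] at the identity, which the projection carries to
   that of [P]. *)
- move=> a b; apply/rowP => r; rewrite mxE cobracketE// -/c /bilin.
  rewrite trmx_mul trmxK !mulmxA -(mulmxA a) -(mulmxA a).
  rewrite (linearized_poisson_map r mG mM sPG sP qP ac ad c1 d1 B0) -/D -/q.
  rewrite mulmx_sumr mulmx_suml summxE mxE; apply: eq_bigr => s _.
  by rewrite -scalemxAr -scalemxAl !mxE mulrC.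
- move=> j; have := linearized_poisson_unimodular mM pP P1 hsmooth hmorse hvol j.
  by move=> E; rewrite -[RHS]E; apply: eq_bigr => s _; rewrite mxE.
Qed.
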